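(* The $4$-colour bipartite Ramsey number of the cycle $C_{2n}$ of order $2n$ is $(5+o(1))n$, and likewise the $4$-colour bipartite Ramsey number of the path $P_{2n}$ of order $2n$ is $(5+o(1))n$, where $o(1)$ denotes a quantity tending to $0$ as $n \to \infty$.
   Context: The $k$-colour bipartite Ramsey number of a bipartite graph $H$ is the least integer $N$ such that every $k$-edge-colouring of the complete bipartite graph $K_{N,N}$ contains a monochromatic copy of $H$. The order of a path or cycle is its number of vertices. *)

(* Defs.v *)
From mathcomp Require Import all_boot.

Set Implicit Arguments.
Unset Strict Implicit.
Unset Printing Implicit Defensive.

(* A finite graph is given by its adjacency relation on a finType. *)

Definition path_graph (m : nat) : rel 'I_m :=
  fun x y => (x.+1 == y :> nat) || (y.+1 == x :> nat).

(* [ordS] is the successor modulo m; this is the simple cycle for 3 <= m. *)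
Definition cycle_graph (m : nat) : rel 'I_m :=
  fun x y => (ordS x == y) || (ordS y == x).

(* The two parts of K_{N,N} are the summands of 'I_N + 'I_N, so its edges are
   the pairs {inl i, inr j}, and a k-edge-colouring of it is a function
   c : 'I_N -> 'I_N -> 'I_k. *)
Definition colour_class (k N : nat) (c : 'I_N -> 'I_N -> 'I_k) (a : 'I_k) :
    rel ('I_N + 'I_N) :=
  fun u v => match u, v with
             | inl i, inr j | inr j, inl i => c i j == a
             | _, _ => false
             end.

(* A copy is a not necessarily induced subgraph, hence an implication. *)
Definition has_copy (V W : finType) (H : rel V) (G : rel W) : Prop :=
  exists2 f : V -> W, injective f & forall x y, H x y -> G (f x) (f y).

Definition bipartite_arrows (k : nat) (V : finType) (H : rel V) (N : nat) :
    Prop :=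
  forall c : 'I_N -> 'I_N -> 'I_k, exists a, has_copy H (colour_class c a).

Definition is_bipartite_ramsey_number (k : nat) (V : finType) (H : rel V)
    (N : nat) : Prop :=
  bipartite_arrows k H N /\ forall M, bipartite_arrows k H M -> N <= M.

(* Main.v *)
(* Lower bound: blow up a 4-colouring of K_{5,5} in which every colour class is
   a star forest, replacing each vertex by n - 1 vertices; every monochromatic
   component then has a side of n - 1 vertices.

   Upper bound, combinatorial core: in a 4-colouring of an almost complete
   bipartite graph with sides of size k > 5q suppose that no colour has a
   connected matching of size > q, let W_c be a minimum vertex cover of colour c
   and T(v) the set of colours c with v in W_c.  By Koenig's theorem W_c meets
   each component in at most q vertices and in at most as many as either side
   of the component has.  Since v is joined to the whole other side, T(v) is
   not empty, and if T(v) = {c}, the component of v in colour c has more than 2q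
   vertices on the side opposite to v.  Hence |W_c| plus the number of v with
   T(v) = {c} is at most k, with room to spare if there are such v.  But the sum
   over c is that of |T(v)| + [|T(v)| = 1] >= 2 over the 2k vertices, so all 4
   colours are tight, which is impossible.

   Transfer to K_{N,N}: instead of regularity, partition the two sides into
   clusters such that in almost every pair of clusters each colour that occurs
   also occurs between any two subsets of positive proportion.  The number of
   colours occurring in a pair is monotone under refinement and serves as the
   potential.  A depth-first search gives nearly spanning paths in the pairs of
   a connected matching of clusters, which are linked through the component and
   closed up; the length is made exact by a greedy path in one dense pair. *)
Require Import Defs.
From mathcomp Require Import all_boot zify.

Set Implicit Arguments.
Unset Strict Implicit.
Unset Printing Implicit Defensive.

(** * Koenig's theorem *)

(* [lia] is too slow on goals that contain cardinals and sums: every maximal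
   non-arithmetic subterm is abstracted first. *)
Ltac abstract_atoms t :=
  lazymatch t with
  | addn ?a ?b => abstract_atoms a; abstract_atoms b
  | subn ?a ?b => abstract_atoms a; abstract_atoms b
  | muln ?a ?b => abstract_atoms a; abstract_atoms b
  | S ?a => abstract_atoms a
  | half ?a => abstract_atoms a
  | O => idtac
  | _ => tryif is_var t then idtac else generalize t
  end.

Ltac abstract_goal :=
  repeat match goal with
  | H : is_true (leq _ _) |- _ => revert H
  | H : @eq nat _ _ |- _ => revert H
  end;
  repeat match goal with
  | |- context [leq ?a ?b] => progress (abstract_atoms a; abstract_atoms b)
  | |- context [@eq nat ?a ?b] => progress (abstract_atoms a; abstract_atoms b)
  end;
  clear; intros.

Ltac card_lia := abstract_goal; lia.
Ltac card_nia := abstract_goal; nia.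

Definition bimatching (I J : finType) (M : {set I * J}) :=
  {in M &, forall e f, (e.1 == f.1) || (e.2 == f.2) -> e = f}.

Definition bicover (I J : finType) (E : {set I * J}) (X : {set I}) (Y : {set J}) :=
  [forall e in E, (e.1 \in X) || (e.2 \in Y)].

(** Among the subsets of [E] that still need as many cover vertices as [E] does, an
    inclusion-minimal one turns out to be a matching, and the left ends of a matching cover it. *)
Lemma koenig (I J : finType) (E : {set I * J}) :
  exists (M : {set I * J}) (X : {set I}) (Y : {set J}), [/\ M \subset E, bimatching M, bicover E X Y & #|X| + #|Y| <= #|M|].
Proof.
pose cov (F : {set I * J}) (C : {set I} * {set J}) := bicover F C.1 C.2.
pose sz (C : {set I} * {set J}) := #|C.1| + #|C.2|.
have covT F : cov F (setT, setT) by apply/forall_inP=> e _; rewrite inE.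
case: (arg_minnP sz (covT E)) => C0 covC0 minC0.
pose t := sz C0.
pose P (F : {set I * J}) := [forall C, cov F C ==> (t <= sz C)].
have PE : P E by apply/forallP=> C; apply/implyP=> /minC0.
have [F /minsetP[PF minF] FE] : {F | minset P F & F \subset E}.
  exact: (minset_exists PE).
have tF C : cov F C -> t <= sz C.
  by move=> h; apply: (implyP (forallP PF C)).
have crit e : e \in F -> exists2 C, cov (F :\ e) C & sz C < t.
  move=> eF; have : ~~ P (F :\ e).
    apply/negP=> /minF/(_ (subD1set F e)) eqF.
    by move: eF; rewrite -eqF !inE eqxx.
  rewrite negb_forall => /existsP[C]; rewrite negb_imply -ltnNge => /andP[? ?].
  by exists C.
have covD1 e C : cov (F :\ e) C -> sz C < t -> (e.1 \notin C.1) && (e.2 \notin C.2).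
  move=> cC; apply: contraTT; rewrite -negb_or negbK -leqNgt => eC.
  apply: tF; apply/forall_inP=> f fF; have [->|fe] := eqVneq f e; first by [].
  by apply: (forall_inP cC); rewrite !inE fe.
have tM (C : {set I} * {set J}) : cov F C -> t <= #|C.1| + #|C.2| by move/tF.
have mF : bimatching F.
  move=> e f eF fF; apply: contraTeq => ef.
  have [C1 c1 s1] := crit e eF; have [C2 c2 s2] := crit f fF.
  have /andP[e1 e2] := covD1 _ _ c1 s1; have /andP[f1 f2] := covD1 _ _ c2 s2.
  have f12 : (f.1 \in C1.1) || (f.2 \in C1.2).
    by apply: (forall_inP c1); rewrite !inE fF eq_sym ef.
  have e12 : (e.1 \in C2.1) || (e.2 \in C2.2).
    by apply: (forall_inP c2); rewrite !inE eF ef.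
  have cover_other g : g \in F -> g != e -> g != f ->
     ((g.1 \in C1.1) || (g.2 \in C1.2)) && ((g.1 \in C2.1) || (g.2 \in C2.2)).
    move=> gF ge gf; apply/andP; split.
      by apply: (forall_inP c1); rewrite !inE ge gF.
    by apply: (forall_inP c2); rewrite !inE gf gF.
  have UI1 := cardsUI C1.1 C2.1; have UI2 := cardsUI C1.2 C2.2.
  (* A common left end of [e] and [f] lies in neither cover, so both right ends lie in the union of
     the right parts. Intersecting the left parts and uniting the right parts thus covers [F]; so
     does the opposite combination with the common end added. The two sizes sum to at most 2(t - 1)
     + 1 < 2t. A common right end is symmetric. *)
  apply/negP=> /orP[/eqP E1|/eqP E2].
  - have k1 : t <= #|C1.1 :&: C2.1| + #|C1.2 :|: C2.2|.
      apply: (tM (_, _)); apply/forall_inP=> g gF /=.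
      have [->|ge] := eqVneq g e.
        by move: e12; rewrite !inE E1 (negbTE f1) /= => ->; rewrite ?orbT.
      have [->|gf] := eqVneq g f.
        by move: f12; rewrite !inE -E1 (negbTE e1) /= => ->; rewrite ?orbT.
      by move: (cover_other _ gF ge gf); rewrite !inE; do 4!case: (_ \in _); rewrite ?orbT.
    have k2 : t <= #|e.1 |: (C1.1 :|: C2.1)| + #|C1.2 :&: C2.2|.
      apply: (tM (_, _)); apply/forall_inP=> g gF /=.
      have [->|ge] := eqVneq g e; first by rewrite !inE eqxx.
      have [->|gf] := eqVneq g f; first by rewrite !inE -E1 eqxx.
      by move: (cover_other _ gF ge gf); rewrite !inE; do 4!case: (_ \in _); rewrite ?orbT.
    have := cardsU1 e.1 (C1.1 :|: C2.1).
    move: s1 s2 k1 k2 UI1 UI2; rewrite /sz; case: (_ \notin _) => /= *; card_lia.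
  - have k1 : t <= #|C1.1 :|: C2.1| + #|C1.2 :&: C2.2|.
      apply: (tM (_, _)); apply/forall_inP=> g gF /=.
      have [->|ge] := eqVneq g e.
        by move: e12; rewrite !inE E2 (negbTE f2) /= orbF => ->; rewrite ?orbT.
      have [->|gf] := eqVneq g f.
        by move: f12; rewrite !inE -E2 (negbTE e2) /= orbF => ->; rewrite ?orbT.
      by move: (cover_other _ gF ge gf); rewrite !inE; do 4!case: (_ \in _); rewrite ?orbT.
    have k2 : t <= #|C1.1 :&: C2.1| + #|e.2 |: (C1.2 :|: C2.2)|.
      apply: (tM (_, _)); apply/forall_inP=> g gF /=.
      have [->|ge] := eqVneq g e; first by rewrite !inE eqxx ?orbT.
      have [->|gf] := eqVneq g f; first by rewrite !inE -E2 eqxx ?orbT.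
      by move: (cover_other _ gF ge gf); rewrite !inE; do 4!case: (_ \in _); rewrite ?orbT.
    have := cardsU1 e.2 (C1.2 :|: C2.2).
    move: s1 s2 k1 k2 UI1 UI2; rewrite /sz; case: (_ \notin _) => /= *; card_lia.
exists F, C0.1, C0.2; split=> //.
have covF : cov F ([set e.1 | e in F], set0).
  by apply/forall_inP=> e eF; rewrite imset_f.
by apply: leq_trans (tF _ covF) _; rewrite /sz /= cards0 addn0 leq_imset_card.
Qed.

(** * Connected matchings in four colours *)

Lemma leq_card_bigcup (I T : finType) (F : I -> {set T}) :
  #|\bigcup_i F i| <= \sum_i #|F i|.
Proof.
elim/big_rec2: _ => [|i m A _ IH]; first by rewrite cards0.
by apply: leq_trans (leq_card_setU _ _) _; rewrite leq_add2l.
Qed.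

Lemma card_root_fibres (V : finType) (e : rel V) (A : {set V}) :
  #|A| = \sum_r #|[set v in A | root e v == r]|.
Proof.
rewrite -sum1_card (partition_big (root e) predT) //=.
by apply: eq_bigr => r _; rewrite -sum1dep_card.
Qed.

Section ConnectedMatching.
Variables (V : finType) (side : pred V) (g : 'I_4 -> rel V).
Variables (k h q : nat) (bad : {set V}).
Hypothesis g_sym : forall c, symmetric (g c).
Hypothesis g_side : forall c u v, g c u v -> side v = ~~ side u.
Hypothesis card_side : forall b, #|[set v | side v == b]| = k.
Hypothesis card_bad : #|bad| <= 2 * h.
Hypothesis good_deg : forall v, v \notin bad ->
  #|[set w | (side w == ~~ side v) && ~~ [exists c, g c v w]]| <= h.
Hypothesis small_matching : forall c (M : {set V * V}) u, bimatching M ->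
  {in M, forall e, [&& ~~ side e.1, g c e.1 e.2 & connect (g c) u e.1]} -> #|M| <= q.

(** Components of colour [c] are indexed by all vertices [r]. The fibre over a vertex that is no
    root is empty, so sums over [r] run over the components. *)
Let rt c v := root (g c) v.
Let y c r b := #|[set v | (rt c v == r) && (side v == b)]|.

Let csym c : connect_sym (g c).
Proof. exact: sym_connect_sym. Qed.

Let rt_edge c u v : g c u v -> rt c v = rt c u.
Proof. by move=> guv; apply/(rootP (csym c)); apply: connect1; rewrite g_sym. Qed.

Let sum_y c b : \sum_r y c r b = k.
Proof.
rewrite -(card_side b) (card_root_fibres (g c)).
by apply: eq_bigr => r _; apply: eq_card => v; rewrite !inE andbC.
Qed.

(** Koenig duality localises to components: each matching edge has its own vertex in the cover, and
    the cover is no larger than the matching, so in a component the cover is at most the part of the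
    matching there. That part is at most [q] by [small_matching], and at most either side by
    projection. *)
Lemma component_cover c : exists W : {set V},
  (forall u v, g c u v -> (u \in W) || (v \in W)) /\
  forall r, let w := #|[set v in W | rt c v == r]| in
    w <= q /\ forall b, w <= y c r b.
Proof.
pose E := [set e : V * V | ~~ side e.1 && g c e.1 e.2].
have [M [X [Y [ME mM cE le]]]] := koenig E.
have Me e : e \in M -> ~~ side e.1 && g c e.1 e.2.
  by move=> eM; move: (subsetP ME _ eM); rewrite inE.
pose W := [set x in X | ~~ side x] :|: [set x in Y | side x].
have leW : #|W| <= #|M|.
  apply: leq_trans le; apply: leq_trans (leq_card_setU _ _) _.
  by apply: leq_add; apply: subset_leq_card; apply/subsetP=> x; rewrite inE => /andP[].
have cW u v : g c u v -> (u \in W) || (v \in W).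
  move=> guv; have sv := g_side guv.
  have [su|su] := boolP (side u).
    have /(forall_inP cE) /= : (v, u) \in E by rewrite inE /= sv su g_sym.
    by rewrite !inE sv su /= ?andbT ?andbF ?orbF => /orP[->|->]; rewrite ?orbT.
  have /(forall_inP cE) /= : (u, v) \in E by rewrite inE /= su guv.
  by rewrite !inE sv su /= ?andbT ?andbF ?orbF => /orP[->|->]; rewrite ?orbT.
clearbody W; exists W; split=> // r /=.
pose Mr := [set e in M | rt c e.1 == r].
pose W' := [set v in W | rt c v != r].
pose f (e : V * V) := if e.1 \in W then e.1 else e.2.
have fW e : e \in M -> f e \in W.
  by move=> /Me/andP[_ /cW]; rewrite /f; case: ifP => // _ ->.
have rf e : e \in M -> rt c (f e) = rt c e.1.
  by move=> /Me/andP[_ /rt_edge]; rewrite /f; case: ifP.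
have injf : {in M &, injective f}.
  move=> e e' eM eM'; rewrite /f.
  have /andP[s1 /g_side s2] := Me _ eM; have /andP[s1' /g_side s2'] := Me _ eM'.
  case: ifP => _; case: ifP => _ E'; apply: mM => //.
  - by rewrite E' eqxx.
  - by move: s2'; rewrite -E' (negbTE s1) (negbTE s1').
  - by move: s2; rewrite E' (negbTE s1) (negbTE s1').
  - by rewrite E' eqxx orbT.
(* Outside the component the matching injects into the cover; subtracting this from [leW] bounds the
   cover inside the component. *)
have leM' : #|M :\: Mr| <= #|W'|.
  rewrite -(card_in_imset (f := f)); last first.
    by move=> e e'; rewrite !inE => /andP[_ ?] /andP[_ ?]; apply: injf.
  apply: subset_leq_card; apply/subsetP=> _ /imsetP[e + ->].
  by rewrite !inE => /andP[ne eM]; rewrite fW //= rf //; rewrite eM in ne.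
have le_r : #|[set v in W | rt c v == r]| <= #|Mr|.
  have h1 := cardsID Mr M.
  have -> : [set v in W | rt c v == r] = W :\: W'.
    by apply/setP=> v; rewrite !inE negb_and negbK; case: (v \in W); rewrite /= ?andbT ?andbF.
  have h2 := cardsID W' W.
  have e1 : M :&: Mr = Mr by apply/setIidPr; apply/subsetP=> e; rewrite inE => /andP[].
  have e2 : W :&: W' = W' by apply/setIidPr; apply/subsetP=> e; rewrite inE => /andP[].
  move: h1 h2; rewrite e1 e2; card_lia.
split.
  apply: leq_trans le_r _; apply: (small_matching (c := c) (u := r)).
    by move=> e e'; rewrite !inE => /andP[? _] /andP[? _]; apply: mM.
  move=> e; rewrite inE => /andP[/Me/andP[-> ->] /eqP <-] /=.
  by rewrite (csym c) connect_root.
move=> b; apply: leq_trans le_r _.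
pose p (e : V * V) := if b then e.2 else e.1.
rewrite -(card_in_imset (f := p)); last first.
  move=> e e'; rewrite !inE /p => /andP[? _] /andP[? _] E'; apply: mM => //.
  by move: E'; case: (b) => ->; rewrite eqxx ?orbT.
apply: subset_leq_card; apply/subsetP=> _ /imsetP[e + ->].
rewrite !inE /p => /andP[/Me/andP[s1 gg] r1].
by case: (b); rewrite ?(rt_edge gg) r1 ?(g_side gg) (negbTE s1).
Qed.

(** The count of the overview with errors: [h] absorbs the missing neighbours of good vertices and
    the bad vertices. The coefficient 9 comes from the case |T(v)| = 2. *)
Lemma connected_matching_bound : k <= 5 * q + 9 * h.
Proof.
rewrite leqNgt; apply/negP=> big_k.
have [W Wcov] := fin_all_exists component_cover.
have cW c u v : g c u v -> (u \in W c) || (v \in W c) by have [+ _] := Wcov c; apply.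
pose w c r := #|[set v in W c | rt c v == r]|.
have wq c r : w c r <= q by have [_ /(_ r)[]] := Wcov c.
have wy c r b : w c r <= y c r b by have [_ /(_ r)[_ +]] := Wcov c; apply.
have sum_w c : #|W c| = \sum_r w c r by rewrite (card_root_fibres (g c)).
pose T v := [set c | v \in W c].
(* In a colour outside [T v], all neighbours of [v] belong to the cover of the component of [v], so
   there are at most [q] of them. In a colour of [T v] only the size of the opposite side of the
   component is available. *)
have deg v : v \notin bad ->
    k <= h + (\sum_(c in T v) y c (rt c v) (~~ side v) + #|~: T v| * q).
  move=> vbad; rewrite -(card_side (~~ side v)).
  pose Z c := [set u | (side u == ~~ side v) && g c v u].
  have sub : [set u | side u == ~~ side v] \subset
     [set u | (side u == ~~ side v) && ~~ [exists c, g c v u]] :|: \bigcup_c Z c.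
    apply/subsetP=> u; rewrite !inE => -> /=.
    have [//|ex] := boolP (~~ _); apply/bigcupP.
    by move: ex; rewrite negbK => /existsP[c gc]; exists c; rewrite // inE (g_side gc) eqxx.
  apply: leq_trans (subset_leq_card sub) _; apply: leq_trans (leq_card_setU _ _) _.
  apply: leq_add; first exact: good_deg.
  apply: leq_trans (leq_card_bigcup _) _.
  rewrite (bigID (mem (T v))) /= -sum_nat_const.
  rewrite [X in _ <= _ + X](eq_bigl (fun c => c \notin T v)); last by move=> c; rewrite !inE.
  apply: leq_add; apply: leq_sum => c cT.
    by apply: subset_leq_card; apply/subsetP=> u; rewrite !inE => /andP[-> /rt_edge ->]; rewrite eqxx.
  apply: leq_trans (wq c (rt c v)); apply: subset_leq_card; apply/subsetP=> u.
  rewrite !inE => /andP[_ gu]; rewrite (rt_edge gu) eqxx andbT.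
  by move: (cW _ _ _ gu) cT; rewrite inE; case: (v \in W c).
have cardT v : #|T v| + #|~: T v| = 4 by rewrite cardsC card_ord.
pose S c b := [set v | [&& v \notin bad, T v == [set c] & side v == b]].
have SE c b v : (v \in S c b) = [&& v \notin bad, T v == [set c] & side v == b].
  by rewrite inE.
clearbody S.
have degS c b v : v \in S c b -> k <= h + (y c (rt c v) (~~ b) + 3 * q).
  rewrite SE => /and3P[vb /eqP Tv /eqP sb]; move: (deg v vb) (cardT v).
  by rewrite Tv big_set1 sb cards1 => + e; have -> : #|~: [set c]| = 3 by card_lia.
have SW c b v : v \in S c b -> v \in W c.
  by rewrite SE => /and3P[_ /eqP/setP/(_ c)]; rewrite !inE eqxx.
pose s c b r := #|[set v in S c b | rt c v == r]|.
have sw c b r : s c b r <= w c r.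
  by apply: subset_leq_card; apply/subsetP=> v; rewrite !inE => /andP[/SW ->].
(* Once [s c b r] is positive, [degS] makes the opposite side at least k - 3q - h, whereas [w] and
   [s] are at most [q] each; the difference is the slack. *)
have swy c b r : w c r + s c b r <= y c r (~~ b) /\
   (0 < s c b r -> w c r + s c b r + (k - 5 * q - h) <= y c r (~~ b)).
  have := wq c r; have := wy c r (~~ b); have := sw c b r.
  have [->|/card_gt0P[v]] := posnP (s c b r); first by rewrite addn0; split.
  rewrite inE => /andP[/degS + /eqP rv]; rewrite rv; card_lia.
have sum_s c b : #|S c b| = \sum_r s c b r by rewrite (card_root_fibres (g c)).
have capb c b : #|W c| + #|S c b| <= k.
  rewrite sum_w sum_s -big_split /= -(sum_y c (~~ b)).
  by apply: leq_sum => r _; case: (swy c b r).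
have capb' c b : 0 < #|S c b| -> #|W c| + #|S c b| + (k - 5 * q - h) <= k.
  case/card_gt0P=> v vS; have pos : 0 < s c b (rt c v).
    by apply/card_gt0P; exists v; rewrite inE vS eqxx.
  rewrite sum_w sum_s -big_split /= -[X in _ <= X](sum_y c (~~ b)).
  rewrite (bigD1 (rt c v)) //= [X in _ <= X](bigD1 (rt c v)) //=.
  have h1 := (swy c b (rt c v)).2 pos.
  have h2 : \sum_(i | i != rt c v) (w c i + s c b i) <= \sum_(i | i != rt c v) y c i (~~ b).
    by apply: leq_sum => r _; case: (swy c b r).
  card_lia.
have wsum1 c r b : #|W c| + y c r b <= q + k.
  rewrite sum_w -(sum_y c b) (bigD1 r) //= [X in _ <= _ + X](bigD1 r) //=.
  have := wq c r; have : \sum_(i | i != r) w c i <= \sum_(i | i != r) y c i b.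
    by apply: leq_sum => i _; apply: wy.
  card_lia.
(* An edge between two vertices covered only in colour [c] has colour [c] itself, so its ends share
   a component; the exceptions are non-neighbours of [v]. *)
have Sout c b v : v \in S c b -> #|[set u in S c (~~ b) | rt c u != rt c v]| <= h.
  move=> vS; have := vS; rewrite SE => /and3P[vb /eqP Tv /eqP sv].
  apply: leq_trans (good_deg vb); apply: subset_leq_card; apply/subsetP=> u.
  rewrite !inE SE => /andP[/and3P[_ /eqP Tu /eqP su] ru]; rewrite sv su eqxx /=.
  apply/negP=> /existsP[d gd]; move: (cW _ _ _ gd).
  have -> : v \in W d = (d == c) by move/setP: Tv => /(_ d); rewrite !inE.
  have -> : u \in W d = (d == c) by move/setP: Tu => /(_ d); rewrite !inE.
  by rewrite orbb => /eqP E; move: ru; rewrite -E (rt_edge gd) eqxx.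
have split_r c b r : #|S c b| = s c b r + #|[set u in S c b | rt c u != r]|.
  rewrite -(cardsID [set u | rt c u == r] (S c b)); congr (_ + _).
    by apply: eq_card => u; rewrite !inE.
  by apply: eq_card => u; rewrite !inE andbC.
(* If one of the two sets has at most [h] elements, [capb'] suffices. Otherwise nearly all of both
   sets lies in one component, as disjoint parts of its cover, so together they have at most q + 2h
   elements; the large side of that component gives |W c| <= 4q + h through [wsum1]. *)
have both c : 0 < #|S c true| + #|S c false| ->
    #|W c| + #|S c true| + #|S c false| + (k - 5 * q) <= k + 3 * h.
  move=> pos.
  have [lt|lt] := leqP #|S c true| h.
    have [z|z] := posnP #|S c false|.
      have := capb' c true; card_lia.
    have := capb' c false z; card_lia.
  have [lf|lf] := leqP #|S c false| h.
    have := capb' c true; card_lia.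
  have /card_gt0P[v vS] : 0 < #|S c true| by card_lia.
  have o1 := Sout _ _ _ vS; have e1 := split_r c false (rt c v).
  have /card_gt0P[u] : 0 < s c false (rt c v) by move: o1 => /=; card_lia.
  rewrite inE => /andP[uS /eqP ruv].
  have o2 := Sout _ _ _ uS; have e2 := split_r c true (rt c v); rewrite ruv in o2.
  have disj : s c true (rt c v) + s c false (rt c v) <= w c (rt c v).
    rewrite -cardsUI (_ : _ :&: _ = set0) ?cards0 ?addn0; last first.
      by apply/setP=> z; rewrite !inE !SE; case: (side z); rewrite /= ?andbF.
    apply: subset_leq_card; apply/subsetP=> z; rewrite in_setU => /orP[].
      by rewrite inE => /andP[/SW zW zr]; rewrite inE zW.
    by rewrite inE => /andP[/SW zW zr]; rewrite inE zW.
  have := wq c (rt c v); have := wsum1 c (rt c v) false; have := degS _ _ _ vS.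
  move: o1 o2 => /=; card_lia.
have cap c : #|W c| + #|S c true| + #|S c false| <= k.
  have [z|z] := posnP (#|S c true| + #|S c false|).
    have := capb c true; card_lia.
  have := both c z; card_lia.
have cardV : #|V| = 2 * k.
  rewrite -cardsT -(cardsID [set v | side v == true]).
  rewrite (_ : _ :&: _ = [set v | side v == true]); last by apply/setP=> v; rewrite !inE.
  rewrite (_ : _ :\: _ = [set v | side v == false]); last first.
    by apply/setP=> v; rewrite !inE andbT; case: (side v).
  by rewrite !card_side; card_lia.
have card_good : 2 * k <= #|~: bad| + 2 * h.
  by have := cardsC bad; rewrite cardV; card_lia.
have sumT : \sum_c #|W c| = \sum_v #|T v|.
  rewrite (eq_bigr (fun c => \sum_v (v \in W c : nat))); last first.
    by move=> c _; rewrite -sum1_card big_mkcond; apply: eq_bigr => v _; case: (v \in W c).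
  rewrite exchange_big; apply: eq_bigr => v _.
  by rewrite -sum1_card [RHS]big_mkcond; apply: eq_bigr => c _; rewrite inE; case: (v \in W c).
have Tne v : v \notin bad -> 0 < #|T v|.
  move=> vb; rewrite lt0n cards_eq0; apply/eqP=> T0.
  by move: (deg v vb) (cardT v); rewrite T0 big_set0 cards0; card_nia.
pose one v := [exists c, T v == [set c]] && (v \notin bad).
have sum1 : \sum_c (#|S c true| + #|S c false|) = \sum_v (one v : nat).
  rewrite (eq_bigr (fun c => \sum_v ((T v == [set c]) && (v \notin bad) : nat))); last first.
    move=> c _; rewrite -cardsUI (_ : _ :&: _ = set0) ?cards0 ?addn0; last first.
      by apply/setP=> v; rewrite !inE !SE; case: (side v); rewrite /= ?andbF.
    rewrite -sum1_card big_mkcond; apply: eq_bigr => v _; rewrite inE !SE.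
    by case: (T v == _); case: (v \in bad); case: (side v).
  rewrite exchange_big; apply: eq_bigr => v _ /=; rewrite /one.
  case: (v \in bad); rewrite ?andbF; first by rewrite big1 // => c _; rewrite andbF.
  rewrite andbT; have [/existsP[c /eqP Tc]|nex] := boolP [exists c, T v == [set c]].
    rewrite (bigD1 c) //= Tc eqxx big1 // => d dc.
    have [/setP/(_ d)|//] := eqVneq [set c] [set d].
    by rewrite !inE eqxx (negbTE dc).
  rewrite big1 // => c _; have [Tc|//] := eqVneq (T v) [set c].
  by move: nex; rewrite negb_exists => /forallP/(_ c); rewrite Tc eqxx.
have low v : v \notin bad -> 2 <= #|T v| + one v.
  move=> vb; have := Tne v vb; rewrite leq_eqVlt => /orP[|]; last by card_lia.
  rewrite eq_sym => /cards1P[c Tc]; rewrite /one vb andbT.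
  by rewrite (_ : [exists d, T v == [set d]]) ?Tc ?cards1 //; apply/existsP; exists c.
have lowsum m : (forall v, v \notin bad -> m <= #|T v| + one v) ->
    m * #|~: bad| <= \sum_c (#|W c| + #|S c true| + #|S c false|).
  move=> hm; rewrite (eq_bigr (fun c => #|W c| + (#|S c true| + #|S c false|))); last first.
    by move=> c _; rewrite addnA.
  rewrite big_split /= sumT sum1 -big_split /= (bigID (mem bad)) /=.
  rewrite mulnC -sum_nat_const; apply: leq_trans (leq_addl _ _).
  rewrite (eq_bigl (fun v => v \notin bad)); last by move=> v; rewrite inE.
  exact: leq_sum.
have total := lowsum 2 low.
(* Three colours contribute at most [k] each, and [total] makes the sum at least 4k - 4h; hence
   every colour contributes at least k - 4h. *)
have others c0 : \sum_c (#|W c| + #|S c true| + #|S c false|) <=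
    #|W c0| + #|S c0 true| + #|S c0 false| + 3 * k.
  rewrite (bigD1 c0) //= leq_add2l.
  apply: leq_trans (_ : \sum_(c | c != c0) k <= _); first exact: leq_sum.
  rewrite sum_nat_const; apply: leq_mul => //.
  by move: (cardC1 c0); rewrite card_ord => e; apply: eq_leq; apply: etrans e; apply: eq_card.
have [[c pos]|none] : (exists c, 0 < #|S c true| + #|S c false|) \/
    forall c, #|S c true| + #|S c false| = 0.
  have [/existsP[c ?]|] := boolP [exists c, 0 < #|S c true| + #|S c false|].
    by left; exists c.
  by rewrite negb_exists => /forallP ne; right=> c; apply/eqP; rewrite -leqn0 leqNgt.
- have := both c pos; have := others c; card_lia.
have one0 v : one v = false.
  apply/negbTE/negP=> /andP[/existsP[c Tc] vb]; have := none c.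
  suff : 0 < #|S c (side v)| by case: (side v); card_lia.
  by apply/card_gt0P; exists v; rewrite SE vb Tc eqxx.
have [/existsP[v /andP[vb /eqP T2]]|] := boolP [exists v, (v \notin bad) && (#|T v| == 2)].
(* The larger of the two components of [v] has at least (k - h - 2q)/2 vertices opposite [v]. But |W
   c| >= k - 4h and [wsum1] leave at most q + 4h there, whence k <= 4q + 9h. *)
- have [c cT yc] : exists2 c, c \in T v & k <= h + 2 * y c (rt c v) (~~ side v) + 2 * q.
    have /cards2P[c [d [cd Tv]]] : #|T v| == 2 by rewrite T2.
    have := deg v vb; have := cardT v; rewrite T2 => card2.
    have -> : #|~: T v| = 2 by card_lia.
    rewrite Tv big_setU1 ?inE //= big_set1 => le.
    case: (leqP (y c (rt c v) (~~ side v)) (y d (rt d v) (~~ side v))) => le'.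
      by exists d; rewrite ?inE ?eqxx ?orbT //; card_lia.
    by exists c; rewrite ?inE ?eqxx //; card_lia.
  have := wsum1 c (rt c v) (~~ side v); have := others c; have := none c; card_lia.
rewrite negb_exists => /forallP ne.
have low3 v : v \notin bad -> 3 <= #|T v| + one v.
  move=> vb; have := low v vb; have := ne v; rewrite vb one0 /=.
  by case: #|T v| => [|[|[|m]]].
have := lowsum 3 low3; have := others ord0; have := cap ord0; card_lia.
Qed.
End ConnectedMatching.

(** * Stable clusters *)

Lemma subset_of_card (X : finType) (A : {set X}) m :
  m <= #|A| -> exists2 B : {set X}, B \subset A & #|B| = m.
Proof.
move=> le; exists [set x in take m (enum A)].
  by apply/subsetP=> x; rewrite inE => /mem_take; rewrite mem_enum.
rewrite cardsE; have /card_uniqP -> : uniq (take m (enum A)) by rewrite take_uniq ?enum_uniq.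
by rewrite size_takel // -cardE.
Qed.

Definition constant_on (X F : finType) (phi : X -> F) (A : {set X}) :=
  [forall x in A, forall y in A, phi x == phi y].

(** Blocks are cut out of single fibres of [phi] while some fibre has [m] elements left. After that
    at most |F|(m - 1) elements remain, so at most |F| blocks are still to be cut, and only these
    can fail to be constant. *)
Lemma blocks_exist (X F : finType) (phi : X -> F) m L (A : {set X}) :
  0 < m -> L * m <= #|A| ->
  exists (B : nat -> {set X}) (R : {set X}),
  [/\ forall l, l < L -> B l \subset A /\ #|B l| = m,
      forall l l', l < L -> l' < L -> l != l' -> [disjoint B l & B l'],
      \sum_(l < L) ~~ constant_on phi (B l) <= #|F|,
      #|R| + L * m = #|A| &
      forall x, x \in A -> x \in R \/ exists2 l, l < L & x \in B l].
Proof.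
move=> m0; elim: L A => [|L IH] A leA.
  exists (fun=> set0), A; split=> // [||x xA].
  - by rewrite big_ord0.
  - by rewrite addn0.
  - by left.
have [C CA [cC constC]] : exists2 C : {set X}, C \subset A &
    #|C| = m /\ (constant_on phi C \/ L.+1 <= #|F|).
  have [/existsP[f lef]|/existsPn nof] := boolP [exists f, m <= #|[set x in A | phi x == f]|].
    have [C CA cC] := subset_of_card lef; exists C.
      by apply: subset_trans CA _; apply/subsetP=> x; rewrite inE => /andP[].
    split=> //; left; apply/forall_inP=> x /(subsetP CA); rewrite inE => /andP[_ /eqP ->].
    by apply/forall_inP=> y /(subsetP CA); rewrite inE => /andP[_ /eqP ->].
  have [C CA cC] : exists2 C : {set X}, C \subset A & #|C| = m.
    by apply: subset_of_card; apply: leq_trans leA; rewrite mulSn leq_addr.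
  exists C => //; split=> //; right.
  have : #|A| <= #|F| * m.-1.
    rewrite -sum1_card (partition_big phi predT) //= -sum_nat_const.
    apply: leq_sum => f _; rewrite sum1dep_card.
    by have := nof f; rewrite -ltnNge; case: (m) m0.
  move: leA; case: (m) m0 => // m' _ /= h1 h2.
  by have := leq_trans h1 h2; rewrite leqNgt => /negP h; rewrite leqNgt; apply/negP=> h'; apply: h; nia.
have cAC : #|A :\: C| + m = #|A|.
  by rewrite -cC addnC -(cardsID C A) (setIidPr CA).
have [|B [R [sB dB cB cR cov]]] := IH (A :\: C).
  by rewrite -(leq_add2r m) cAC addnC.
pose B' l := if l == L then C else B l.
have ltB l : l < L.+1 -> l != L -> l < L by rewrite ltnS leq_eqVlt => /orP[->|].
have dC l : l < L -> [disjoint B l & C].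
  move=> /sB[+ _]; rewrite subsetD => /andP[_]; exact.
have B'L l : l < L -> B' l = B l.
  by rewrite /B'; case: eqP => // ->; rewrite ltnn.
exists B', R; split.
- move=> l ll; rewrite /B'; have [//|/(ltB l ll)/sB[sBl cBl]] := eqVneq l L.
  by split=> //; apply: subset_trans sBl _; apply: subsetDl.
- move=> l l' ll ll' ne; rewrite /B'.
  have [E|/(ltB l ll) nl] := eqVneq l L; have [E'|/(ltB l' ll') nl'] := eqVneq l' L.
  + by move: ne; rewrite E E' eqxx.
  + by rewrite disjoint_sym dC.
  + exact: dC.
  + exact: dB.
- case: constC => [constC|lF]; last first.
    apply: leq_trans lF; rewrite -[X in _ <= X]card_ord -sum1_card.
    by apply: leq_sum => l _; apply: leq_b1.
  rewrite big_ord_recr /= /B' eqxx constC addn0.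
  rewrite (eq_bigr (fun l : 'I_L => ~~ constant_on phi (B l) : nat)) // => l _.
  by rewrite -/(B' l) B'L.
- by rewrite -cAC -cR mulSn; lia.
- move=> x xA; have [xC|xC] := boolP (x \in C).
    by right; exists L => //; rewrite /B' eqxx.
  have [|xR|[l ll xl]] := cov x; first by rewrite inE xC.
    by left.
  by right; exists l; rewrite ?B'L // ltnS ltnW.
Qed.

(** A constant block lies inside the saturated set [S] or misses it, so the rest of [S] is in [R]
    and the few non-constant blocks. This yields many blocks inside a large [S]. *)
Lemma blocks_inside (X F : finType) (phi : X -> F) m L (A R : {set X})
    (B : nat -> {set X}) (S : {set X}) :
  (forall l, l < L -> #|B l| = m) ->
  \sum_(l < L) ~~ constant_on phi (B l) <= #|F| ->
  (forall x, x \in A -> x \in R \/ exists2 l, l < L & x \in B l) ->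
  S \subset A -> (forall x y, phi x = phi y -> (x \in S) = (y \in S)) ->
  #|S| <= (\sum_(l < L) (B l \subset S) + #|F|) * m + #|R|.
Proof.
move=> cB cF cov SA sat.
have : S \subset R :|: \bigcup_(l < L) (S :&: B l).
  apply/subsetP=> x xS; have [xR|[l ll xl]] := cov x (subsetP SA x xS).
    by rewrite inE xR.
  by rewrite inE; apply/orP; right; apply/bigcupP; exists (Ordinal ll); rewrite // inE xS.
move/subset_leq_card => h; apply: leq_trans h _.
apply: leq_trans (leq_card_setU _ _) _; rewrite addnC leq_add2r.
apply: leq_trans (leq_card_bigcup _) _.
apply: leq_trans (_ : (\sum_(l < L) ((B l \subset S) + ~~ constant_on phi (B l))) * m <= _).
  rewrite big_distrl /=; apply: leq_sum => l _; rewrite -(cB l (ltn_ord l)).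
  have [cst|] := boolP (constant_on phi (B l)); last first.
    by rewrite addn1 mulSn; move=> _; apply: leq_trans (leq_addr _ _); rewrite subset_leq_card // subsetIr.
  have [->|/set0Pn[x]] := eqVneq (S :&: B l) set0; first by rewrite cards0.
  rewrite inE => /andP[xS xl].
  rewrite (_ : B l \subset S) ?mul1n ?subset_leq_card ?subsetIr //.
  apply/subsetP=> y yl; rewrite -(sat x) //; apply/eqP.
  by apply: (forall_inP (forall_inP cst x xl)).
by rewrite big_split /= leq_mul2r leq_add2l cF orbT.
Qed.

Definition colours_on (X Y K : finType) (c : X -> Y -> K) (S : {set X}) (T : {set Y}) :=
  [set a | [exists x in S, exists y in T, c x y == a]].

Lemma colours_onP (X Y K : finType) (c : X -> Y -> K) (S : {set X}) (T : {set Y}) a :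
  reflect (exists x y, [/\ x \in S, y \in T & c x y = a]) (a \in colours_on c S T).
Proof.
rewrite inE; apply: (iffP existsP) => [[x /andP[xS /existsP[y /andP[yT /eqP e]]]]|].
  by exists x, y.
by case=> x [y [xS yT e]]; exists x; rewrite xS; apply/existsP; exists y; rewrite yT e eqxx.
Qed.

Lemma colours_onS (X Y K : finType) (c : X -> Y -> K) (S S' : {set X}) (T T' : {set Y}) :
  S \subset S' -> T \subset T' -> colours_on c S T \subset colours_on c S' T'.
Proof.
move=> /subsetP sS /subsetP sT; apply/subsetP=> a /colours_onP[x [y [xS yT e]]].
by apply/colours_onP; exists x, y; split; auto.
Qed.

(* The substitute for regularity: unlike a density, the set of colours occurring
   in a pair can only shrink when passing to subsets. *)
Definition stable_pair (X Y K : finType) (c : X -> Y -> K) p (A : {set X}) (B : {set Y}) :=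
  [forall a in colours_on c A B, forall S : {set X}, forall T : {set Y},
    [==> S \subset A, T \subset B, #|A| <= p * #|S|, #|B| <= p * #|T|
     => a \in colours_on c S T]].

Definition clusters (X I : finType) (A : I -> {set X}) s :=
  (forall i, #|A i| = s) /\ (forall i j, i != j -> [disjoint A i & A j]).

Definition potential (X Y K I : finType) (c : X -> Y -> K) (A : I -> {set X}) (B : I -> {set Y}) :=
  \sum_i \sum_j #|colours_on c (A i) (B j)|.

Definition unstable (X Y K I : finType) (c : X -> Y -> K) p
    (A : I -> {set X}) (B : I -> {set Y}) : {set I * I} :=
  [set ij | ~~ stable_pair c p (A ij.1) (B ij.2)].

Lemma refine_pair (X Y K : finType) (c : X -> Y -> K) (A : nat -> {set X}) (B : nat -> {set Y})
    (A0 S : {set X}) (B0 T : {set Y}) L a g :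
  (forall l, l < L -> A l \subset A0) -> (forall l, l < L -> B l \subset B0) ->
  a \in colours_on c A0 B0 -> a \notin colours_on c S T ->
  g <= \sum_(l < L) (A l \subset S) -> g <= \sum_(l < L) (B l \subset T) ->
  \sum_(l < L) \sum_(l' < L) #|colours_on c (A l) (B l')| + g ^ 2
    <= L ^ 2 * #|colours_on c A0 B0|.
Proof.
move=> sA sB aAB aST gA gB.
have h : g ^ 2 <= \sum_(l < L) \sum_(l' < L) ((A l \subset S) && (B l' \subset T) : nat).
  apply: leq_trans (leq_mul gA gB) _; rewrite big_distrl /=.
  apply: leq_sum => l _; rewrite big_distrr /=; apply: leq_sum => l' _.
  by rewrite mulnb.
apply: leq_trans (leq_add (leqnn _) h) _.
rewrite -big_split /=.
apply: leq_trans (_ : \sum_(l < L) L * #|colours_on c A0 B0| <= _); last first.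
  by rewrite sum_nat_const card_ord mulnA.
apply: leq_sum => l _; rewrite -big_split /=.
apply: leq_trans (_ : \sum_(l < L) #|colours_on c A0 B0| <= _); last first.
  by rewrite sum_nat_const card_ord.
apply: leq_sum => l' _.
have sub : colours_on c (A l) (B l') \subset colours_on c A0 B0.
  by apply: colours_onS; auto.
have [/andP[AS BT]|_] := boolP (_ && _); last by rewrite addn0 subset_leq_card.
rewrite addn1; apply: proper_card; rewrite properE sub /=.
apply: contra aST => /subsetP/(_ a aAB); apply: subsetP; exact: colours_onS.
Qed.

(** Every cluster is cut along the witness sets of all its unstable pairs at once. A witness set
    holds a 1/p share of its cluster, the worth of 2g blocks when there are 2pg of them; [g] exceeds
    by one the number 2^|I| of possible traces on the witness sets. *)
Lemma refine_step (X Y K I : finType) (c : X -> Y -> K) (A : I -> {set X}) (B : I -> {set Y})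
    p s g s' :
  0 < p -> clusters A s -> clusters B s -> g = (2 ^ #|I|).+1 ->
  s' = s %/ (2 * p * g) -> 2 * p * g <= s' ->
  exists (A' : I * 'I_(2 * p * g) -> {set X}) (B' : I * 'I_(2 * p * g) -> {set Y}),
  [/\ clusters A' s', clusters B' s' &
     potential c A' B' + #|unstable c p A B| * g ^ 2 <= (2 * p * g) ^ 2 * potential c A B].
Proof.
set L := 2 * p * g => p0 [cA dA] [cB dB] gE s'E Ls'.
have g0 : 0 < g by rewrite gE.
have L0 : 0 < L by rewrite /L !muln_gt0 p0 g0.
have Lm : L * s' <= s by rewrite s'E mulnC leq_trunc_div.
have ltL : s < L * s' + L by rewrite s'E [X in X + _]mulnC -mulSnr; apply: ltn_ceil.
have [ST hST] : exists ST : I * I -> {set X} * {set Y}, forall ij, ij \in unstable c p A B ->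
   exists2 a, a \in colours_on c (A ij.1) (B ij.2) & [/\ (ST ij).1 \subset A ij.1,
     (ST ij).2 \subset B ij.2, s <= p * #|(ST ij).1|, s <= p * #|(ST ij).2| &
     a \notin colours_on c (ST ij).1 (ST ij).2].
  apply: (fin_all_exists (P := fun ij (st : {set X} * {set Y}) => ij \in unstable c p A B -> exists2 a, _ & [/\ st.1 \subset _, st.2 \subset _, s <= p * #|st.1|, s <= p * #|st.2| & a \notin colours_on c st.1 st.2])) => ij.
  have [st|st] := boolP (stable_pair c p (A ij.1) (B ij.2)).
    by exists (set0, set0); rewrite inE st.
  move: st; rewrite negb_forall => /existsP[a]; rewrite negb_imply => /andP[aAB].
  rewrite negb_forall => /existsP[S]; rewrite negb_forall => /existsP[T].
  rewrite !negb_imply !cA !cB => /and5P[sS sT lS lT aST].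
  by exists (S, T) => _; exists a.
(* The trace of [x] on the witness sets of its cluster, so that each of these sets is saturated for
   it. *)
pose phiA i x := [set j | x \in (ST (i, j)).1].
pose phiB j y := [set i | y \in (ST (i, j)).2].
have s'0 : 0 < s' by apply: leq_trans Ls'.
have BA i := blocks_exist (phiA i) s'0 (eq_ind_r (fun z => L * s' <= z) Lm (cA i)).
have BB j := blocks_exist (phiB j) s'0 (eq_ind_r (fun z => L * s' <= z) Lm (cB j)).
have {BA} [fA hA] := fin_all_exists BA; have {BB} [fB hB] := fin_all_exists BB.
exists (fun il : I * 'I_L => fA il.1 il.2), (fun il : I * 'I_L => fB il.1 il.2).
have clus (Z : finType) (D : I -> {set Z}) (f : I -> nat -> {set Z}) :
    (forall i j, i != j -> [disjoint D i & D j]) ->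
    (forall i, (forall l, l < L -> f i l \subset D i /\ #|f i l| = s') /\
      (forall l l', l < L -> l' < L -> l != l' -> [disjoint f i l & f i l'])) ->
    clusters (fun il : I * 'I_L => f il.1 il.2) s'.
  move=> dD hf; split=> [[i l]|[i l] [j l'] ne] /=.
    by have [/(_ l (ltn_ord l))[]] := hf i.
  have [E|ij] := eqVneq i j.
    rewrite -E; have [_] := hf i; apply=> //.
    by apply: contra ne => /eqP/val_inj ->; rewrite E.
  have [/(_ l (ltn_ord l))[si _] _] := hf i; have [/(_ l' (ltn_ord l'))[sj _] _] := hf j.
  by apply: disjointWl si _; apply: disjointWr sj _; apply: dD.
(* Of the at least 2gs' elements of [S], fewer than gs' are lost: at most g - 1 blocks are not
   constant, and [R] has fewer than L <= s' elements. *)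
have many (Z : finType) (D S : {set Z}) (f : nat -> {set Z}) (R : {set Z}) (psi : Z -> {set I}) :
    #|D| = s -> (forall l, l < L -> f l \subset D /\ #|f l| = s') ->
    \sum_(l < L) ~~ constant_on psi (f l) <= #|{set I}| -> #|R| + L * s' = #|D| ->
    (forall x, x \in D -> x \in R \/ exists2 l, l < L & x \in f l) ->
    S \subset D -> s <= p * #|S| -> (forall x y, psi x = psi y -> (x \in S) = (y \in S)) ->
    g <= \sum_(l < L) (f l \subset S).
  move=> cD hf hF hR cov SD lS sat.
  have := blocks_inside (fun l ll => (hf l ll).2) hF cov SD sat.
  have -> : #|{set I}| = g.-1 by rewrite -cardsT -powersetT card_powerset cardsT gE.
  set m := (\sum_(l < L) _) => le.
  have RL : #|R| < L by move: ltL; rewrite -cD -hR addnC ltn_add2l.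
  have lS2 : 2 * g * s' <= #|S|.
    rewrite -(leq_pmul2l p0); apply: leq_trans lS; apply: leq_trans Lm.
    by rewrite /L; apply: eq_leq; rewrite !mulnA [p * 2]mulnC.
  rewrite leqNgt; apply/negP=> mg.
  have : 2 * g * s' < 2 * g * s'; last by rewrite ltnn.
  apply: leq_ltn_trans lS2 _; apply: leq_ltn_trans le _.
  apply: leq_trans (_ : (m + g.-1).+1 * s' <= _).
    by rewrite mulSn addnC ltn_add2r; apply: leq_trans Ls'.
  by rewrite leq_mul2r; apply/orP; right; lia.
split.
- by apply: (clus _ A fA dA) => i; have [R [h1 h2 _ _ _]] := hA i.
- by apply: (clus _ B fB dB) => i; have [R [h1 h2 _ _ _]] := hB i.
rewrite /potential big_distrr /=.
rewrite (eq_bigr (fun il : I * 'I_L => \sum_j \sum_(l' < L) #|colours_on c (fA il.1 il.2) (fB j l')|)); last first.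
  by move=> il _; rewrite -(pair_bigA _ (fun j (l' : 'I_L) => #|colours_on c (fA il.1 il.2) (fB j l')|)).
rewrite -(pair_bigA _ (fun i (l : 'I_L) => \sum_j \sum_(l' < L) #|colours_on c (fA i l) (fB j l')|)) /=.
have -> : #|unstable c p A B| * g ^ 2 = \sum_i \sum_j ((i, j) \in unstable c p A B) * g ^ 2.
  rewrite -sum1_card big_distrl /= big_mkcond (pair_bigA _ (fun i j => ((i, j) \in unstable c p A B) * g ^ 2)) /=.
  by apply: eq_bigr => -[i j] _ /=; case: (_ \in _).
rewrite -big_split /=; apply: leq_sum => i _; rewrite exchange_big -big_split /= big_distrr /=.
apply: leq_sum => j _.
have [RA [sA _ FA cRA covA]] := hA i; have [RB [sB _ FB cRB covB]] := hB j.
have [un|_] := boolP ((i, j) \in unstable c p A B).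
  have [a aAB [/= SA TB lS lT aST]] := hST _ un; rewrite mul1n.
  apply: (refine_pair (fun l ll => (sA l ll).1) (fun l ll => (sB l ll).1) aAB aST).
    by apply: (many _ _ _ _ _ _ (cA i) sA FA cRA covA) => // x y /setP/(_ j); rewrite !inE.
  by apply: (many _ _ _ _ _ _ (cB j) sB FB cRB covB) => // x y /setP/(_ i); rewrite !inE.
rewrite mul0n addn0.
apply: leq_trans (_ : \sum_(l < L) \sum_(l' < L) #|colours_on c (A i) (B j)| <= _); last first.
  by rewrite !sum_nat_const card_ord mulnA.
apply: leq_sum => l _; apply: leq_sum => l' _; apply: subset_leq_card.
by apply: colours_onS; [have [] := sA l (ltn_ord l)|have [] := sB l' (ltn_ord l')].
Qed.

Lemma refine_until_stable p d k : 0 < p -> exists C, forall (X Y K I : finType)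
    (c : X -> Y -> K) (A : I -> {set X}) (B : I -> {set Y}) s,
  #|I| = k -> clusters A s -> clusters B s -> C <= s ->
  4 * p ^ 3 * potential c A B <= d * k ^ 2 ->
  exists (J : finType) (A' : J -> {set X}) (B' : J -> {set Y}) s',
    [/\ clusters A' s', clusters B' s', k <= #|J| <= C, k * s <= #|J| * s' + C &
        p * #|unstable c p A' B'| <= #|J| ^ 2].
Proof.
move=> p0; elim: d k => [|d IH] k.
  exists k => X Y K I c A B s cI cA cB _ pot; exists I, A, B, s; rewrite cI leqnn.
  split=> //; first by rewrite leq_addr.
  rewrite [#|_|](_ : _ = 0) ?muln0 //; apply/eqP; rewrite cards_eq0 -subset0.
  apply/subsetP=> -[i j]; rewrite inE /= negb_forall => /existsP[a].
  rewrite negb_imply => /andP[aAB _]; exfalso.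
  have : potential c A B = 0.
    have p3 : 0 < 4 * p ^ 3 by rewrite muln_gt0 expn_gt0 p0.
    by apply/eqP; move: pot; rewrite mul0n leqn0 muln_eq0 (gtn_eqF p3).
  rewrite /potential (bigD1 i) //= (bigD1 j) //= => /eqP; rewrite !addn_eq0 cards_eq0.
  by move=> /andP[/andP[/eqP e _] _]; move: aAB; rewrite e inE.
pose g := (2 ^ k).+1; pose L := 2 * p * g.
have [C hC] := IH (k * L).
have L0 : 0 < L by rewrite /L !muln_gt0 p0.
(* The term kL pays for the remainders of the [k] clusters, L(C + L) keeps the new clusters large
   enough for both the refinement and the recursion, and [k] covers stopping at once. *)
exists (C + k * L + L * (C + L) + k) => X Y K I c A B s cI cA cB Cs pot.
have [st|/ltnW un] := leqP (p * #|unstable c p A B|) (k ^ 2).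
  exists I, A, B, s; rewrite cI leqnn leq_addl; split=> //; exact: leq_addr.
have CLs : C + L <= s %/ L.
  rewrite leq_divRL // mulnC; apply: leq_trans Cs.
  by rewrite -addnA addnCA leq_addr.
have [A' [B' [cA' cB' pot']]] := refine_step c p0 cA cB (congr1 (fun z => (2 ^ z).+1) (esym cI)) (erefl _)
  (leq_trans (leq_addl _ _) CLs).
have cJ : #|{: I * 'I_L}| = k * L by rewrite card_prod cI card_ord.
have [||J [A'' [B'' [s'' [cA'' cB'' /andP[kJ JC] cov st]]]]] := hC _ _ _ _ c A' B' _ cJ cA' cB'.
- exact: leq_trans (leq_addr _ _) CLs.
- rewrite -(leq_add2r (4 * p ^ 3 * (#|unstable c p A B| * g ^ 2))) -mulnDr.
  apply: leq_trans (leq_mul (leqnn _) pot') _.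
  rewrite mulnCA; apply: leq_trans (leq_mul (leqnn _) pot) _.
  apply: leq_trans (_ : d * (k * L) ^ 2 + k ^ 2 * L ^ 2 <= _).
    by apply: eq_leq; rewrite -/L mulSn expnMn; move: (k ^ 2) (L ^ 2) => u v; clear; lia.
  rewrite leq_add2l; apply: leq_trans (leq_mul un (leqnn (L ^ 2))) _.
  apply: eq_leq; rewrite /L; move: #|unstable c p A B| => U; clear.
  by rewrite !expnS !expn0 !muln1; lia.
exists J, A'', B'', s''; split=> //.
  apply/andP; split; first by apply: leq_trans kJ; apply: leq_pmulr.
  by apply: leq_trans JC _; rewrite -!addnA leq_addr.
have : s <= s %/ L * L + L by rewrite -mulSnr ltnW // ltn_ceil.
move/(leq_mul (leqnn k)) => h; apply: leq_trans h _.
rewrite mulnDr [s %/ L * L]mulnC mulnA.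
apply: leq_trans (leq_add cov (leqnn _)) _.
by rewrite -addnA leq_add2l -!addnA leq_add2l leq_addr.
Qed.

(** The start is an arbitrary partition into [k] equal blocks, whose potential is at most kappa k^2;
    this gives the budget 4p^3 kappa. *)
Lemma stable_clusters kappa p k : 0 < p -> 0 < k -> exists C, forall (X Y K : finType)
    (c : X -> Y -> K) N, #|K| = kappa -> #|X| = N -> #|Y| = N -> C <= N ->
  exists (J : finType) (A : J -> {set X}) (B : J -> {set Y}) s,
    [/\ clusters A s, clusters B s, k <= #|J| <= C, N <= #|J| * s + C &
        p * #|unstable c p A B| <= #|J| ^ 2].
Proof.
move=> p0 k0; have [C hC] := refine_until_stable (4 * p ^ 3 * kappa) k p0.
exists (k * C.+1 + k + C) => X Y K c N cK cX cY CN.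
have Cs : C < N %/ k.
  by rewrite leq_divRL // mulnC; apply: leq_trans CN; rewrite -addnA leq_addr.
have split_into_blocks (Z : finType) : #|Z| = N -> exists A : 'I_k -> {set Z}, clusters A (N %/ k).
  move=> cZ; have le : k * (N %/ k) <= #|[set: Z]| by rewrite cardsT cZ mulnC leq_trunc_div.
  have [A [R [sA dA _ _ _]]] := blocks_exist (fun=> tt) (leq_ltn_trans (leq0n C) Cs) le.
  exists (fun i => A i); split=> [i|i j ij]; first by have [] := sA i (ltn_ord i).
  by apply: dA.
have [A cA] := split_into_blocks X cX; have [B cB] := split_into_blocks Y cY.
have pot : 4 * p ^ 3 * potential c A B <= 4 * p ^ 3 * kappa * k ^ 2.
  rewrite -[leqRHS]mulnA leq_mul2l; apply/orP; right.
  apply: leq_trans (_ : \sum_(i < k) \sum_(j < k) kappa <= _).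
    by apply: leq_sum => i _; apply: leq_sum => j _; rewrite -cK max_card.
  by rewrite !sum_nat_const card_ord mulnA mulnC.
have [J [A' [B' [s' [cA' cB' /andP[kJ JC] cov st]]]]] :=
  hC _ _ _ _ c A B _ (card_ord k) cA cB (ltnW Cs) pot.
exists J, A', B', s'; split=> //.
  by rewrite kJ; apply: leq_trans JC (leq_addl _ _).
have : N <= k * (N %/ k) + k by rewrite mulnC -mulSnr ltnW // ltn_ceil.
by move/leq_trans; apply; rewrite addnAC; lia.
Qed.

(** * Paths without holes *)

(* Depth-first search: [D] holds the abandoned vertices, which have no arc to
   unvisited ones, and [p] is the current path, in reverse. *)
Lemma long_path_of_no_holes (T : finType) (r : rel T) (X : {set T}) e :
  (forall S S' : {set T}, S \subset X -> S' \subset X -> e <= #|S| -> e <= #|S'| ->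
     exists x y, [/\ x \in S, y \in S' & r x y]) ->
  exists p, [/\ uniq p, {subset p <= X}, sorted r p & #|X| <= size p + 2 * e].
Proof.
move=> hf; pose r' x y := r y x.
pose U (D : {set T}) (p : seq T) := X :\: (D :|: [set x in p]).
have e0 : 0 < e.
  rewrite lt0n; apply/negP=> /eqP E.
  have [||||x [y []]] := hf set0 set0; rewrite ?sub0set ?E //.
  by rewrite inE.
(* Both moves of the search, visiting a vertex and abandoning one, lower the measure 2|U| + |p| by
   one. The search stops when [D] would reach size [e]; then the unvisited set has fewer than [e]
   elements. *)
suff H n : forall (D : {set T}) (p : seq T), D \subset X -> #|D| < e -> uniq p -> {subset p <= X} ->
    {in p, forall x, x \notin D} -> sorted r' p ->
    {in D & U D p, forall x y, ~~ r x y} -> 2 * #|U D p| + size p < n ->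
    exists p, [/\ uniq p, {subset p <= X}, sorted r p & #|X| <= size p + 2 * e].
  apply: (H (2 * #|U set0 [::]| + 0).+1 set0 [::]) => //; rewrite ?sub0set ?cards0 //.
  by move=> x y; rewrite inE.
elim: n => // n IH D p DX De up pX pD sp noarc le.
have cardX : #|X| = #|D| + size p + #|U D p|.
  have dDp : D :&: [set x in p] = set0.
    by apply/setP=> x; rewrite !inE; case xD: (x \in D) => //=; apply/negP=> /pD; rewrite xD.
  have cp : #|[set x in p]| = size p by rewrite cardsE; apply/card_uniqP.
  have sub : D :|: [set x in p] \subset X.
    by rewrite subUset DX; apply/subsetP=> x; rewrite inE; apply: pX.
  by rewrite -(cardsID (D :|: [set x in p]) X) (setIidPr sub) cardsU dDp cards0 subn0 cp.
case: p => [|x p] in up pX pD sp noarc le cardX *.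
  have [U0|/set0Pn[x xU]] := eqVneq (U D [::]) set0.
    by exists [::]; split=> //; rewrite cardX U0 cards0 /=; lia.
  apply: (IH D [:: x]) => //.
  - by move=> y; rewrite inE => /eqP ->; move: xU; rewrite inE => /andP[].
  - by move=> y; rewrite inE => /eqP ->; move: xU; rewrite !inE => /andP[/norP[]].
  - move=> y z yD zU; apply: noarc => //; move: zU; rewrite !inE !negb_or.
    by move=> /andP[/andP[-> _] ->].
  have -> : U D [:: x] = U D [::] :\ x.
    by apply/setP=> z; rewrite !inE; case: (z == x); rewrite /= ?orbT ?orbF.
  by move: le; rewrite (cardsD1 x (U D [::])) xU /=; card_lia.
have [/existsP[y /andP[yU rxy]]|/existsPn nox] := boolP [exists y, (y \in U D (x :: p)) && r x y].
  apply: (IH D (y :: x :: p)) => //.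
  - by rewrite cons_uniq up andbT; move: yU; rewrite !inE => /andP[/norP[]].
  - by move=> z; rewrite inE => /orP[/eqP ->|/pX //]; move: yU; rewrite inE => /andP[].
  - by move=> z; rewrite inE => /orP[/eqP ->|/pD //]; move: yU; rewrite !inE => /andP[/norP[]].
  - by move: sp; rewrite /= {2}/r' rxy.
  - move=> z t zD tU; apply: noarc => //; move: tU; rewrite !inE !negb_or.
    by move=> /andP[/and3P[-> _ ->] ->].
  have -> : U D (y :: x :: p) = U D (x :: p) :\ y.
    by apply/setP=> z; rewrite !inE; case: (z == y); rewrite /= ?orbT ?orbF.
  by move: le; rewrite (cardsD1 y (U D (x :: p))) yU /=; card_lia.
have xD : x \notin D by apply: pD; rewrite inE eqxx.
have UE : U (x |: D) p = U D (x :: p).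
  by apply/setP=> z; rewrite !inE; case: (z == x); rewrite /= ?orbT.
have noarc' : {in x |: D & U (x |: D) p, forall y z, ~~ r y z}.
  move=> y z; rewrite UE !in_setU1 => /orP[/eqP ->|yD] zU; last exact: noarc.
  by have := nox z; rewrite zU.
have cD : #|x |: D| = #|D|.+1 by rewrite cardsU1 xD.
have xDX : x |: D \subset X by rewrite subUset DX sub1set pX // inE eqxx.
have [lt|ge] := ltnP #|x |: D| e.
  apply: (IH (x |: D) p) => //.
  - by case/andP: up.
  - by move=> y yp; apply: pX; rewrite inE yp orbT.
  - move=> y yp; rewrite in_setU1 negb_or pD ?inE ?yp ?orbT // andbT.
    by apply: contraTneq yp => ->; case/andP: up.
  - exact: path_sorted sp.
  - by rewrite UE; move: le => /=; card_lia.
exists (rev (x :: p)); split.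
- by rewrite rev_uniq.
- by move=> y; rewrite mem_rev; apply: pX.
- by rewrite rev_sorted.
have : #|U D (x :: p)| < e.
  rewrite ltnNge; apply/negP; rewrite -UE => geU.
  have [|//|//|y [z [yD zU ryz]]] := hf _ (U (x |: D) p) xDX; first exact: subsetDl.
  by have := noarc' y z yD zU; rewrite ryz.
by rewrite size_rev cardX /=; move: De; card_lia.
Qed.

Definition no_holes (T : finType) (H : rel T) e (S S' : {set T}) :=
  forall Z Z' : {set T}, Z \subset S -> Z' \subset S' -> e <= #|Z| -> e <= #|Z'| ->
  exists x y, [/\ x \in Z, y \in Z' & H x y].

Lemma no_holesS (T : finType) (H : rel T) e (S S' Z Z' : {set T}) :
  Z \subset S -> Z' \subset S' -> no_holes H e S S' -> no_holes H e Z Z'.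
Proof.
move=> ZS ZS' h W W' WZ WZ'; apply: h; first exact: subset_trans ZS.
exact: subset_trans ZS'.
Qed.

(** A vertex cover leaves fewer than [e] vertices uncovered on some side, so Koenig gives a matching
    of size l + 2e. The search runs on its edges, with an arc from [z] to [z'] when [z.2] is
    adjacent to [z'.1]. *)
Lemma alternating_path (T : finType) (H : rel T) (S S' : {set T}) e l :
  symmetric H -> no_holes H e S S' -> l + 3 * e <= #|S| -> l + 3 * e <= #|S'| ->
  exists zs : seq (T * T), [/\ size zs = l, uniq (unzip1 zs), uniq (unzip2 zs),
    all (fun z => [&& z.1 \in S, z.2 \in S' & H z.1 z.2]) zs &
    sorted (fun z z' => H z.2 z'.1) zs].
Proof.
move=> symH nh lS lS'.
have [M [P [Q [ME mM cE le]]]] := koenig [set z : T * T | [&& z.1 \in S, z.2 \in S' & H z.1 z.2]].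
have Me z : z \in M -> [&& z.1 \in S, z.2 \in S' & H z.1 z.2].
  by move=> zM; move: (subsetP ME z zM); rewrite inE.
have lM : l + 2 * e <= #|M|.
  have c1 := cardsID P S; have c2 := cardsID Q S'.
  have i1 : #|S :&: P| <= #|P| by rewrite subset_leq_card ?subsetIr.
  have i2 : #|S' :&: Q| <= #|Q| by rewrite subset_leq_card ?subsetIr.
  have [lt|ge] := ltnP #|S :\: P| e; first by card_lia.
  have [lt|ge'] := ltnP #|S' :\: Q| e; first by card_lia.
  have [x [y [xP yQ xy]]] := nh _ _ (subsetDl _ _) (subsetDl _ _) ge ge'.
  move: xP yQ; rewrite !inE => /andP[xP xS] /andP[yQ yS].
  have /(forall_inP cE) : (x, y) \in [set z : T * T | [&& z.1 \in S, z.2 \in S' & H z.1 z.2]].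
    by rewrite inE /= xS yS.
  by rewrite /= (negbTE xP) (negbTE yQ).
have [|p [up pM sp lp]] := @long_path_of_no_holes _ (fun z z' => H z.2 z'.1) M e.
  move=> Z Z' ZM ZM' eZ eZ'.
  have [||||x [y [/imsetP[z zZ ->] /imsetP[z' zZ' ->] Hxy]]] :=
      nh [set z.1 | z in Z'] [set z.2 | z in Z].
  - by apply/subsetP=> _ /imsetP[z /(subsetP ZM')/Me/and3P[? _ _] ->].
  - by apply/subsetP=> _ /imsetP[z /(subsetP ZM)/Me/and3P[_ ? _] ->].
  - rewrite card_in_imset // => z z' /(subsetP ZM') zM /(subsetP ZM') zM' E.
    by apply: mM => //; rewrite E eqxx.
  - rewrite card_in_imset // => z z' /(subsetP ZM) zM /(subsetP ZM) zM' E.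
    by apply: mM => //; rewrite E eqxx orbT.
  by exists z', z; split=> //; rewrite symH.
have lep : l <= size p by have := leq_trans lM lp; rewrite leq_add2r.
have tM z : z \in take l p -> z \in M by move/mem_take/pM.
exists (take l p); split.
- exact: size_takel.
- rewrite map_inj_in_uniq ?take_uniq // => z z' /tM zM /tM zM' E.
  by apply: mM => //; rewrite E eqxx.
- rewrite map_inj_in_uniq ?take_uniq // => z z' /tM zM /tM zM' E.
  by apply: mM => //; rewrite E eqxx orbT.
- by apply/allP=> z /tM/Me.
- exact: take_sorted.
Qed.

(** Take subsets maximising the number of edges plus [d] per deleted vertex: a vertex of degree
    below [d] would be worth deleting, and deleting a whole side yields at most 2ds < s^2/4. *)
Lemma min_degree_pair (T : finType) (H : rel T) (S S' : {set T}) s d :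
  symmetric H -> #|S| = s -> #|S'| = s -> 8 * d < s ->
  s ^ 2 <= 4 * (\sum_(x in S) \sum_(y in S') H x y) ->
  exists (P P' : {set T}), [/\ P \subset S, P' \subset S', 0 < #|P|,
    forall x, x \in P -> d <= #|[set y in P' | H x y]| &
    forall y, y \in P' -> d <= #|[set x in P | H y x]|].
Proof.
move=> symH cS cS' ds dense.
pose E (PP : {set T} * {set T}) := \sum_(x in PP.1) \sum_(y in PP.2) H x y.
pose f (PP : {set T} * {set T}) := E PP + d * (#|S :\: PP.1| + #|S' :\: PP.2|).
pose ok (PP : {set T} * {set T}) := (PP.1 \subset S) && (PP.2 \subset S').
have ok0 : ok (S, S') by rewrite /ok !subxx.
case: (arg_maxnP f ok0) => -[P P'] /= /andP[/= PS PS'] maxP.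
have fmax : E (S, S') <= f (P, P').
  by apply: leq_trans (maxP _ ok0); apply: leq_addr.
have cSP : #|S :\: P| + #|P| = s by rewrite -cS -(cardsID P S) (setIidPr PS) addnC.
have cSP' : #|S' :\: P'| + #|P'| = s by rewrite -cS' -(cardsID P' S') (setIidPr PS') addnC.
exists P, P'; split=> //.
- rewrite lt0n cards_eq0; apply/eqP=> P0; move: fmax dense; rewrite /f /E /= P0 big_set0 add0n setD0 cS.
  move: cSP'; move: #|S' :\: P'| #|P'| (\sum_(_ in S) _) => u v w; nia.
- move=> x xP; rewrite leqNgt; apply/negP=> lt.
  have okx : ok (P :\ x, P') by rewrite /ok /= PS' andbT (subset_trans _ PS) ?subD1set.
  have := maxP _ okx; rewrite /f /E /= (big_setD1 x xP) /=.
  have -> : S :\: (P :\ x) = x |: (S :\: P).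
    apply/setP=> z; rewrite !inE negb_and negbK; have [->|zx] := eqVneq z x => //=.
    by rewrite (subsetP PS).
  have -> : \sum_(y in P') H x y = #|[set y in P' | H x y]|.
    rewrite -sum1_card big_mkcond [RHS]big_mkcond; apply: eq_bigr => y _; rewrite inE.
    by case: (y \in P'); case: (H x y).
  rewrite cardsU1 !inE xP /=; move: lt.
  move: #|[set y in P' | H x y]| #|S :\: P| #|S' :\: P'| (\sum_(i in P :\ x) _) => a b c' w; nia.
move=> y yP; rewrite leqNgt; apply/negP=> lt.
have oky : ok (P, P' :\ y) by rewrite /ok /= PS (subset_trans _ PS') ?subD1set.
have := maxP _ oky; rewrite /f /E /=.
have -> : \sum_(x in P) \sum_(z in P') H x z =
    #|[set x in P | H y x]| + \sum_(x in P) \sum_(z in P' :\ y) H x z.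
  rewrite (eq_bigr (fun x => H x y + \sum_(z in P' :\ y) H x z)); last first.
    by move=> x _; rewrite (big_setD1 y yP).
  rewrite big_split /=; congr (_ + _).
  rewrite -sum1_card big_mkcond [RHS]big_mkcond; apply: eq_bigr => x _; rewrite inE symH.
  by case: (x \in P); case: (H y x).
have -> : S' :\: (P' :\ y) = y |: (S' :\: P').
  apply/setP=> z; rewrite !inE negb_and negbK; have [->|zx] := eqVneq z y => //=.
  by rewrite (subsetP PS').
rewrite cardsU1 !inE yP /=; move: lt.
move: #|[set x in P | H y x]| #|S :\: P| #|S' :\: P'| (\sum_(i in P) _) => a b c' w; nia.
Qed.

(** * Long cycles through a connected matching of clusters *)

Definition zigzag (T : Type) (zs : seq (T * T)) := flatten [seq [:: z.1; z.2] | z <- zs].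

Lemma mem_zigzag (T : eqType) (zs : seq (T * T)) x :
  (x \in zigzag zs) = (x \in unzip1 zs) || (x \in unzip2 zs).
Proof.
elim: zs => //= z zs IH; rewrite !inE IH.
by case: (x == z.1); case: (x == z.2); rewrite /= ?orbT.
Qed.

Lemma zigzag_uniq (T : finType) (S S' : {set T}) (zs : seq (T * T)) :
  [disjoint S & S'] -> all (fun z => (z.1 \in S) && (z.2 \in S')) zs ->
  uniq (unzip1 zs) -> uniq (unzip2 zs) -> uniq (zigzag zs).
Proof.
move=> dis; elim: zs => //= z zs IH /andP[/andP[z1 z2] al] /andP[n1 u1] /andP[n2 u2].
have in1 x : x \in unzip1 zs -> x \in S by case/mapP=> y /(allP al)/andP[? _] ->.
have in2 x : x \in unzip2 zs -> x \in S' by case/mapP=> y /(allP al)/andP[_ ?] ->.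
have out x : x \in S -> x \notin S' by move=> xS; rewrite (disjointFr dis xS).
rewrite inE !mem_zigzag !negb_or n1 n2 IH // !andbT /= -?andbA; apply/and3P; split.
- by apply: contraTneq z2 => <-; apply: out.
- by apply/negP=> /in2; rewrite (negbTE (out _ z1)).
- by apply/negP=> /in1/out; rewrite z2.
Qed.

Lemma zigzag_path (T : eqType) (H : rel T) (z : T * T) (zs : seq (T * T)) :
  all (fun z => H z.1 z.2) (z :: zs) -> path (fun z z' => H z.2 z'.1) z zs ->
  [/\ path H z.1 (z.2 :: zigzag zs), last z.1 (z.2 :: zigzag zs) = (last z zs).2
    & size (z.2 :: zigzag zs) = (2 * size zs).+1].
Proof.
elim: zs z => [|z' zs IH] z /=; first by move=> /andP[-> _].
move=> /and3P[h1 h2 al] /andP[h3 pth].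
have [|h4 h5 h6] := IH z' _ pth; first by rewrite /= h2.
by rewrite h1 h3; split=> //; move: h6 => /= [h6]; rewrite -/(zigzag zs) h6 mulnS.
Qed.

Section Cycle.
Variables (T U : finType) (H : rel T) (G : rel U) (V : U -> {set T}) (s e K : nat).
Hypothesis H_sym : symmetric H.
Hypothesis G_sym : symmetric G.
Hypothesis V_clusters : clusters V s.
Hypothesis V_holes : forall u v, G u v -> no_holes H e (V u) (V v).
Hypothesis e_gt0 : 0 < e.
Hypothesis card_U : #|U| = K.

Let cV u : #|V u| = s. Proof. by case: V_clusters. Qed.

Let dV u v x : x \in V u -> x \in V v -> u = v.
Proof.
have [_ d] := V_clusters; move=> xu xv; have [//|/d dis] := eqVneq u v.
by rewrite (disjointFr dis xu) in xv.
Qed.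

(** Neighbourhoods are propagated along the walk: of the 2e allowed vertices of the next cluster,
    fewer than [e] have no neighbour in the current set, so at least [e] remain reachable. *)
Lemma link_exists u pth (S Z F : {set T}) :
  path G u pth -> pth != [::] -> S \subset V u -> e <= #|S| ->
  Z \subset V (last u pth) -> e <= #|Z| ->
  (forall v, v \in pth -> 2 * e <= #|V v :\: F|) ->
  exists x ys y, [/\ x \in S, path H x (rcons ys y), y \in Z,
    all2 (fun z v => z \in V v) (rcons ys y) pth & {in ys, forall z, z \notin F}].
Proof.
elim: pth u S => // v pth IH u S /= /andP[guv gp] _ SV eS ZV eZ big.
case: pth => [|v' pth] in IH gp ZV big *.
  have [x [y [xS yZ xy]]] := V_holes guv SV ZV eS eZ.
  by exists x, [::], y; split=> //=; rewrite ?xy ?(subsetP ZV).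
pose S' := [set y in V v :\: F | [exists x in S, H x y]].
have S'V : S' \subset V v :\: F by apply/subsetP=> y; rewrite inE => /andP[].
have eS' : e <= #|S'|.
  have [//|lt] := leqP e #|S'|.
  have [||x [y [xS]]] := V_holes guv SV _ eS (Z' := (V v :\: F) :\: S').
  - exact: subset_trans (subsetDl _ _) (subsetDl _ _).
  - by rewrite cardsDS //; have := big v; rewrite inE eqxx => /(_ isT); card_lia.
  rewrite in_setD inE negb_and => /andP[/orP[/negP yn|nex] yV] xy; first by case: yn.
  by move: nex; rewrite negb_exists => /forallP/(_ x); rewrite xS xy.
have [||y [zs [z [yS pz zZ al nF]]]] := IH v S' gp isT _ eS' ZV eZ.
- exact: subset_trans S'V (subsetDl _ _).
- by move=> w wp; apply: big; rewrite inE wp orbT.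
move: yS; rewrite inE => /andP[]; rewrite inE => /andP[yF yV] /existsP[x /andP[xS xy]].
exists x, (y :: zs), z; split=> //=; first by rewrite xy.
  by rewrite yV.
by move=> t; rewrite inE => /orP[/eqP ->|/nF].
Qed.

(** A link along a simple path of clusters costs each cluster at most one vertex. *)
Lemma transversal_uniq xs vs : all2 (fun z v => z \in V v) xs vs -> uniq vs ->
  uniq xs /\ forall v, #|[set x in xs] :&: V v| <= 1.
Proof.
elim: xs vs => [|x xs IH] [|v vs] //=.
  by move=> _ _; split=> // v; rewrite (_ : _ :&: _ = set0) ?cards0 //; apply/setP=> z; rewrite !inE.
move=> /andP[xv al] /andP[vvs uvs]; have [uxs card1] := IH vs al uvs.
have inV z : z \in xs -> exists2 v', v' \in vs & z \in V v'.
  move: al; clear; elim: xs vs => // x xs IH [|v vs] //= /andP[xv al].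
  rewrite inE => /orP[/eqP ->|/(IH _ al)[v' v'vs zv]].
    by exists v => //; rewrite inE eqxx.
  by exists v' => //; rewrite inE v'vs orbT.
have nov z : z \in xs -> z \notin V v.
  by move=> /inV[v' v'vs zv']; apply: contra vvs => zv; rewrite (dV zv zv').
split; first by rewrite uxs andbT; apply/negP=> /nov; rewrite xv.
move=> w; have [<-|vw] := eqVneq v w.
  rewrite -(cards1 x); apply: subset_leq_card; apply/subsetP=> z; rewrite !inE.
  by move=> /andP[/orP[//|/nov/negbTE ->]].
apply: leq_trans (card1 w); apply: subset_leq_card; apply/subsetP=> z; rewrite !inE.
move=> /andP[/orP[/eqP ->|-> -> //] xw]; by move: vw; rewrite (dV xv xw) eqxx.
Qed.

(** The growing path is kept open at its end: a set of at least [e] possible ends is carried along,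
    so that the absence of holes applies to it, and the lengths are known only up to an interval. *)
Definition reaches w (X : {set T}) lo hi y := exists p,
  [/\ path H w p, last w p = y, uniq (w :: p), {subset w :: p <= X} & lo <= size p <= hi].

(** An alternating path of [l] pairs is laid in the fresh part of (a, a'). The link enters it at one
    of its first [e] pairs, and the last [e] pairs provide the new ends; this costs fewer than 2e
    pairs and makes the lengths vary by less than 2e. *)
Lemma extend_reaches w u a a' l (X : {set T}) b (W : {set T}) pth :
  W \subset V u -> e <= #|W| -> {in W, forall y, reaches w X b (b + 2 * e) y} ->
  G a a' -> a != a' -> path G u pth -> last u pth = a -> uniq (u :: pth) -> u != a ->
  #|X :&: V a| + l + 3 * e <= s -> #|X :&: V a'| + l + 3 * e <= s -> 2 * e <= l ->
  (forall v, #|X :&: V v| + 2 * e <= s) ->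
  exists (X' : {set T}) b' (W' : {set T}), [/\ W' \subset V a', e <= #|W'|,
    {in W', forall y, reaches w X' b' (b' + 2 * e) y},
    b + 2 * (l - 2 * e) <= b' <= b + 2 * l + size pth + 1 &
    forall v, #|X' :&: V v| <= #|X :&: V v| + 1 + (v \in [:: a; a']) * l].
Proof.
move=> WV eW reach gaa neaa gp lastp up ua la la' el room.
have cD v : #|V v :\: X| + #|X :&: V v| = s by rewrite -(cV v) -(cardsID X (V v)) setIC addnC.
have nh : no_holes H e (V a :\: X) (V a' :\: X).
  by apply: no_holesS (V_holes gaa); apply: subsetDl.
have [||zs [szs u1 u2 al srt]] := alternating_path (l := l) H_sym nh.
- by have := cD a; move: la; card_lia.
- by have := cD a'; move: la'; card_lia.
have al12 : all (fun z => (z.1 \in V a :\: X) && (z.2 \in V a' :\: X)) zs.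
  by apply: sub_all al => z /and3P[-> ->].
have dS : [disjoint V a :\: X & V a' :\: X].
  rewrite -setI_eq0; apply/eqP/setP=> x; rewrite !inE; apply/negP.
  by move=> /andP[/andP[_ xa] /andP[_ xa']]; move: neaa; rewrite (dV xa xa') eqxx.
have uz := zigzag_uniq dS al12 u1 u2.
pose P := [set x in zigzag zs].
have inP1 x : x \in unzip1 zs -> x \in V a :\: X by case/mapP=> z /(allP al12)/andP[? _] ->.
have inP2 x : x \in unzip2 zs -> x \in V a' :\: X by case/mapP=> z /(allP al12)/andP[_ ?] ->.
have PX x : x \in P -> x \notin X.
  by rewrite inE mem_zigzag => /orP[/inP1|/inP2]; rewrite inE => /andP[].
have cP v : #|P :&: V v| <= (v \in [:: a; a']) * l.
  rewrite !inE; have [va|nva] := eqVneq v a.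
    rewrite mul1n -szs -(size_map fst); apply: leq_trans (card_size _).
    apply: subset_leq_card; apply/subsetP=> x; rewrite !inE mem_zigzag.
    move=> /andP[/orP[//|/inP2]]; rewrite inE => /andP[_ xa'] xv.
    by move: neaa; rewrite -va (dV xa' xv) eqxx.
  have [va'|nva'] := eqVneq v a'.
    rewrite mul1n -szs -(size_map snd); apply: leq_trans (card_size _).
    apply: subset_leq_card; apply/subsetP=> x; rewrite !inE mem_zigzag.
    move=> /andP[/orP[/inP1|//]]; rewrite inE => /andP[_ xa] xv.
    by move: nva; rewrite (dV xa xv) eqxx.
  rewrite mul0n leqn0 cards_eq0; apply/eqP/setP=> x; rewrite !inE mem_zigzag; apply/negP.
  move=> /andP[/orP[/inP1|/inP2]]; rewrite inE => /andP[_ xa] xv.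
    by move: nva; rewrite (dV xa xv) eqxx.
  by move: nva'; rewrite (dV xa xv) eqxx.
pose Z := [set x in unzip1 (take e zs)].
have ele : e <= l by card_lia.
have [||||x [ys [y [xW pxy yZ al2 ynF]]]] :=
    link_exists (F := X :|: P) gp _ WV eW (Z := Z).
- by case: (pth) lastp ua => //= ->; rewrite eqxx.
- rewrite lastp; apply/subsetP=> x; rewrite inE => /mapP[z /mem_take zz ->].
  by have := inP1 z.1 (map_f _ zz); rewrite inE => /andP[].
- rewrite cardsE (card_uniqP _) ?size_map ?size_takel ?szs //.
  by rewrite /unzip1 map_take take_uniq.
- move=> v _; have -> : V v :\: (X :|: P) = (V v :\: X) :\: (P :&: V v).
    by apply/setP=> t; rewrite !inE; case: (t \in X); case: (t \in zigzag zs); case: (t \in V v).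
  have := cP v; have := cD v; have := cardsD (V v :\: X) (P :&: V v).
  have : #|(V v :\: X) :&: (P :&: V v)| <= #|P :&: V v| by rewrite subset_leq_card ?subsetIr.
  have := room v; rewrite !inE; have [->|_] := eqVneq v a; first by move: la; card_lia.
  by have [->|_] := eqVneq v a'; move: la'; card_lia.
have [uxs cxs] := transversal_uniq al2 (proj2 (andP up)).
have sxs : size (rcons ys y) = size pth by move: al2; rewrite all2E => /andP[/eqP].
have [p [pw lastw uwp pX /andP[lop hip]]] := reach x xW.
move: yZ; rewrite inE => /mapP[z zt yz].
have [p1 [p2 zt1]] : exists p1 p2 : seq (T * T), take e zs = p1 ++ z :: p2.
  by case/splitPr: zt => p1 p2; exists p1, p2.
have zsE : zs = p1 ++ z :: (p2 ++ drop e zs) by rewrite -{1}(cat_take_drop e zs) zt1 -catA.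
have p1e : size p1 < e.
  by have := congr1 size zt1; rewrite size_takel ?szs // size_cat /=; card_lia.
set zs2 := p2 ++ drop e zs in zsE.
(* At least k + 1 further pairs follow the entry pair [z] before the path may stop. *)
pose k := l - e - size p1 - 1.
have szs2 : size zs2 = k + e.
  by have := congr1 size zsE; rewrite szs size_cat /= /k; card_lia.
have dropE : drop (l - e) zs = drop k zs2.
  rewrite zsE drop_cat; have -> : l - e < size p1 = false by card_lia.
  by have -> : l - e - size p1 = k.+1 by rewrite /k; card_lia.
exists ([set t in rcons ys y] :|: (X :|: P)), (size p + size (rcons ys y) + 2 * k.+1 + 1),
  [set t in unzip2 (drop (l - e) zs)].
split.
- apply/subsetP=> t; rewrite inE => /mapP[z' /mem_drop zz ->].
  by have := inP2 z'.2 (map_f _ zz); rewrite inE => /andP[].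
- rewrite cardsE (card_uniqP _) ?size_map ?size_drop ?szs //; first by card_lia.
  by rewrite /unzip2 map_drop drop_uniq.
- move=> t; rewrite inE dropE => /mapP[z' zd tz].
  have [q1 [q2 zd1]] : exists q1 q2 : seq (T * T), drop k zs2 = q1 ++ z' :: q2.
    by case/splitPr: zd => q1 q2; exists q1, q2.
  have zs2E : zs2 = rcons (take k zs2 ++ q1) z' ++ q2.
    by rewrite -{1}(cat_take_drop k zs2) zd1 cat_rcons catA.
  have q1e : size q1 < e.
    by have := congr1 size zd1; rewrite size_drop szs2 size_cat /=; card_lia.
  set mid := rcons _ _ in zs2E.
  have smid : size mid = k.+1 + size q1.
    by rewrite size_rcons size_cat size_takel ?szs2 ?leq_addr // addSn.
  have sub_all (r : pred (T * T)) : all r zs -> all r (z :: mid).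
    by rewrite zsE zs2E all_cat /= all_cat => /and4P[_ -> ->].
  have [||pseg lastseg sseg] := @zigzag_path _ H z mid.
  + by apply: sub_all; apply: sub_all al => ? /and3P[].
  + move: srt; rewrite zsE zs2E; case: (p1) => [|z1 p1'] /=.
      by rewrite cat_path => /andP[].
    by rewrite cat_path /= cat_path => /and4P[_ _ ->].
  have zzE : zigzag zs = zigzag p1 ++ zigzag (z :: mid) ++ zigzag q2.
    by rewrite {1}zsE zs2E -cat_cons /zigzag !map_cat !flatten_cat.
  have useg : uniq (zigzag (z :: mid)).
    by move: uz; rewrite zzE cat_uniq => /and3P[_ _]; rewrite cat_uniq => /and3P[].
  have segP t' : t' \in zigzag (z :: mid) -> t' \in P.
    by rewrite [t' \in P]inE zzE !mem_cat => ->; rewrite orbT.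
  exists (p ++ rcons ys y ++ z.2 :: zigzag mid); split.
  + by rewrite cat_path pw lastw cat_path pxy last_rcons yz.
  + by rewrite last_cat lastw last_cat last_rcons yz lastseg /mid last_rcons.
  + have := useg; rewrite /zigzag [flatten _]/= cons_uniq -/(zigzag mid) -yz => /andP[yn uzz].
    rewrite -cat_cons cat_uniq uwp cat_uniq uxs uzz !andTb !andbT.
    apply/andP; split.
      apply/hasPn=> t'; rewrite mem_cat => tt; apply/negP=> /pX tX.
      case/orP: tt => tt; last by have := PX t' (segP t' _); rewrite tX inE tt orbT => /(_ isT).
      move: tt; rewrite mem_rcons inE => /orP[/eqP E|/ynF].
        by have := PX t' (segP t' _); rewrite tX E yz inE eqxx => /(_ isT).
      by rewrite inE tX.
    apply/hasPn=> t' tt; rewrite mem_rcons inE negb_or; apply/andP; split.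
      by apply: contraNneq yn => <-.
    apply/negP=> /ynF; rewrite inE negb_or (segP t') ?andbF //.
    by rewrite /zigzag /= inE tt orbT.
  + move=> t'; rewrite -cat_cons mem_cat => /orP[/pX tX|]; first by rewrite !inE tX !orbT.
    rewrite mem_cat => /orP[tt|tt]; first by rewrite !inE tt.
    by rewrite inE in_setU (segP t') ?orbT // /zigzag /= inE tt orbT.
  + by rewrite !size_cat sseg smid; card_lia.
- by rewrite sxs /k; move: lop hip p1e el; card_lia.
move=> v; rewrite setIUl setIUl.
have := (leq_card_setU ([set t in rcons ys y] :&: V v) (X :&: V v :|: P :&: V v)).1.
have := (leq_card_setU (X :&: V v) (P :&: V v)).1.
by have := cxs v; have := cP v; card_lia.
Qed.

(** The matched pairs are traversed in turn until the length is just below the target [L]. The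
    counter [i] is the number of links so far, each taking at most one vertex of any cluster; [usd]
    separates the two sides of the reduced graph. *)
Lemma tour (ps : seq (U * U)) (usd : pred U) r w l m L :
  (forall p, p \in ps -> [&& G p.1 p.2, ~~ usd p.1, usd p.2 & connect G r p.1]) ->
  uniq (unzip1 ps) -> uniq (unzip2 ps) -> m + l + 3 * e <= s -> 2 * e <= l ->
  forall (X : {set T}) b (W : {set T}) u i,
  W \subset V u -> e <= #|W| -> {in W, forall y, reaches w X b (b + 2 * e) y} ->
  usd u -> connect G r u ->
  (forall v, #|X :&: V v| <= i + l) ->
  (forall v, v \in unzip1 ps ++ unzip2 ps -> #|X :&: V v| <= i) ->
  i + size ps <= m -> b <= L -> L <= b + size ps * (2 * (l - 2 * e)) + (4 * e + K + 2) ->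
  exists (X' : {set T}) b' (W' : {set T}) u',
    [/\ [/\ W' \subset V u', e <= #|W'|, {in W', forall y, reaches w X' b' (b' + 2 * e) y},
          usd u' & connect G r u'],
        b' <= L <= b' + (4 * e + K + 2), forall v, #|X' :&: V v| <= m + l &
        forall v, v \notin unzip1 ps ++ unzip2 ps -> #|X' :&: V v| <= #|X :&: V v| + size ps].
Proof.
move=> psP u1 u2 ml el; elim: ps psP u1 u2 => [|[a a'] ps IH] psP u1 u2 X b W u i WV eW reach us ru Xv Xps im bL Lb.
  exists X, b, W, u; split=> //.
  - by move: Lb; rewrite bL /= mul0n addn0.
  - by move=> v; apply: leq_trans (Xv v) _; rewrite leq_add2r; move: im; rewrite addn0.
  - by move=> v _; rewrite addn0.
have [close|far] := leqP L (b + (4 * e + K + 2)).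
  exists X, b, W, u; split=> //.
  - by rewrite bL.
  - by move=> v; apply: leq_trans (Xv v) _; rewrite leq_add2r; apply: leq_trans im; apply: leq_addr.
  - by move=> v _; apply: leq_addr.
(* The last stretch is shortened so as not to pass [L]: a link has fewer than [K] edges and a
   stretch of l' pairs adds at most 2l' + 1 more. When the second term is the minimum, the new
   length is within 4e + K + 2 of [L]. *)
pose l' := minn l (L - b - K - 1)./2.
have /and4P[/= gaa sa sa' ra] := psP (a, a') (mem_head _ _).
have neaa : a != a' by apply: contraNneq sa => ->.
have ua : u != a by apply: contraTneq us => ->.
have [pth [gp up lastp]] : exists pth : seq U, [/\ path G u pth, uniq (u :: pth) & last u pth = a].
  have /connectP[pth0 gp0 last0] : connect G u a.
    by apply: connect_trans ra; rewrite (sym_connect_sym G_sym).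
  by case/shortenP: gp0 last0 => pth gp up _ ->; exists pth.
have spth : size pth < K by rewrite -card_U; have := max_card (mem (u :: pth)); rewrite (card_uniqP up).
have im' : i + 1 + size ps <= m by move: im => /=; card_lia.
have l'l : l' <= l by rewrite geq_minl.
have l'e : 2 * e <= l'.
  by rewrite leq_min el /=; move: far; card_lia.
have Xa : #|X :&: V a| <= i by apply: Xps; rewrite mem_cat inE eqxx.
have Xa' : #|X :&: V a'| <= i by apply: Xps; rewrite mem_cat [X in _ || X]inE eqxx orbT.
have [||||X' [b' [W' [WV' eW' reach' bb' Xv']]]] :=
    extend_reaches (l := l') WV eW reach gaa neaa gp lastp up ua.
- by move: Xa im' l'l; card_lia.
- by move: Xa' im' l'l; card_lia.
- exact: l'e.
- by move=> v; have := Xv v; move: im' ml; card_lia.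
have ra' : connect G r a' by apply: connect_trans ra (connect1 gaa).
have b'L : b' <= L.
  case/andP: bb' => _; have : l' <= (L - b - K - 1)./2 by rewrite geq_minr.
  by move: far spth; card_lia.
have psP' p : p \in ps -> [&& G p.1 p.2, ~~ usd p.1, usd p.2 & connect G r p.1].
  by move=> pps; apply: psP; rewrite inE pps orbT.
case/andP: u1 => /= na u1; case/andP: u2 => /= na' u2.
have notin_ps v : v \in unzip1 ps ++ unzip2 ps -> v \notin [:: a; a'].
  rewrite mem_cat !inE negb_or => /orP[v1|v2]; apply/andP; split.
  - by apply: contraNneq na => <-.
  - apply: contraTneq sa' => <-; case/mapP: v1 => p pps ->.
    by have /and4P[] := psP' p pps.
  - apply: contraNneq sa => <-; case/mapP: v2 => p pps ->.
    by have /and4P[] := psP' p pps.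
  - by apply: contraNneq na' => <-.
have Xi v : #|X' :&: V v| <= i + 1 + l.
  have := Xv' v; have [|_] := boolP (v \in [:: a; a']).
    by rewrite !inE => /orP[]/eqP ->; move: Xa Xa' l'l; card_lia.
  by have := Xv v; card_lia.
have Xps' v : v \in unzip1 ps ++ unzip2 ps -> #|X' :&: V v| <= i + 1.
  move=> vps; have := Xv' v; rewrite (negbTE (notin_ps v vps)).
  have : #|X :&: V v| <= i by apply: Xps; move: vps; rewrite !mem_cat !inE => /orP[]->; rewrite !orbT.
  by card_lia.
have out v : v \notin unzip1 ((a, a') :: ps) ++ unzip2 ((a, a') :: ps) ->
    v \notin unzip1 ps ++ unzip2 ps /\ #|X' :&: V v| <= #|X :&: V v| + 1.
  rewrite !mem_cat !inE !negb_or => /andP[/andP[va v1] /andP[va' v2]].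
  rewrite v1 v2; split=> //; have := Xv' v.
  by rewrite !inE (negbTE va) (negbTE va') mul0n addn0.
have [full|notfull] := eqVneq l' l.
  have [|X'' [b'' [W'' [u'' [st bb Xm Xo]]]]] :=
      IH psP' u1 u2 X' b' W' a' (i + 1) WV' eW' reach' sa' ra' Xi Xps' im' b'L.
    by move: Lb bb'; rewrite full [size _]/= mulSn; move: (_ * (2 * _)) => z; card_lia.
  exists X'', b'', W'', u''; split=> //.
  by move=> v vn; have [vn' le] := out v vn; have := Xo v vn'; move: le => /=; card_lia.
exists X', b', W', a'; split=> //.
- rewrite b'L; have : l' = (L - b - K - 1)./2.
    by move: notfull; rewrite /l' /minn; case: ltnP => //; rewrite eqxx.
  by move: bb' far spth; card_lia.
- by move=> v; apply: leq_trans (Xi v) _; move: im'; card_lia.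
by move=> v /out[_ le]; apply: leq_trans le _; rewrite leq_add2l.
Qed.

(** The minimum degree exceeds the number of forbidden and already used vertices, so every step has
    a free neighbour; [P] and [P'] swap roles at each step. *)
Lemma greedy_path (P P' X : {set T}) d f t z :
  (forall x, x \in P -> d <= #|[set y in P' | H x y]|) ->
  (forall y, y \in P' -> d <= #|[set x in P | H y x]|) ->
  z \in P -> #|X :&: P| + t + f <= d -> #|X :&: P'| + t + f <= d ->
  exists p, [/\ path H z p, size p = t, uniq p, {in p, forall x, x \notin X}
    & last z p \in if odd t then P' else P].
Proof.
elim: t P P' X z => [|t IH] P P' X z dP dP' zP c c'.
  by exists [::].
have /subsetPn[y] : ~~ ([set y in P' | H z y] \subset X :&: P').
  apply/negP=> /subset_leq_card; have := dP z zP; move: c'; card_lia.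
rewrite !inE => /andP[yP zy]; rewrite yP andbT => yX.
have cy (Q : {set T}) : #|(y |: X) :&: Q| <= #|X :&: Q| + 1.
  rewrite setIUl; have := (leq_card_setU ([set y] :&: Q) (X :&: Q)).1.
  have : #|[set y] :&: Q| <= 1 by rewrite -(cards1 y) subset_leq_card ?subsetIl.
  by card_lia.
have [||p [pp sp up pX lastp]] := IH P' P (y |: X) y dP' dP yP.
- by have := cy P'; card_lia.
- by have := cy P; card_lia.
exists (y :: p); split.
- by rewrite /= zy.
- by rewrite /= sp.
- by rewrite /= up andbT; apply/negP=> /pX; rewrite in_setU1 eqxx.
- move=> x; rewrite inE => /orP[/eqP -> //|/pX].
  by rewrite in_setU1 negb_or => /andP[].
- by rewrite /=; move: lastp; case: (odd t).
Qed.

Lemma path_parity (side : pred T) w p :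
  (forall x y, H x y -> side y = ~~ side x) -> path H w p ->
  side (last w p) = side w (+) odd (size p).
Proof.
move=> bip; elim: p w => [|x p IH] w /=; first by rewrite addbF.
by case/andP=> /bip sx /IH ->; rewrite sx; case: (side w); case: (odd _).
Qed.

(** The pair (a, a') is reserved for closing. The path starts there at [w], tours the other pairs,
    is linked back to the dense subpair (P, P'), gets its exact length by a greedy path, and is
    closed by an edge between a neighbour of its end and a neighbour of [w]. *)
Lemma cycle_of_length (side : pred T) (usd : pred U) (ps : seq (U * U)) a a' l d n :
  (forall x y, H x y -> side y = ~~ side x) ->
  (forall u x, x \in V u -> side x = usd u) ->
  (forall p, p \in (a, a') :: ps -> [&& G p.1 p.2, ~~ usd p.1, usd p.2 & connect G a p.1]) ->
  uniq (unzip1 ((a, a') :: ps)) -> uniq (unzip2 ((a, a') :: ps)) ->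
  s ^ 2 <= 4 * (\sum_(x in V a) \sum_(y in V a') H x y) -> 8 * d < s ->
  10 * e + 2 * K + size ps + 10 <= d -> size ps + l + 3 * e <= s -> 2 * e <= l ->
  2 * e + K + 6 <= 2 * n -> 2 * n <= size ps * (2 * (l - 2 * e)) ->
  exists q, [/\ size q = 2 * n, uniq q & cycle H q].
Proof.
move=> bip sideV psP u1 u2 dense ds ed psl el n_low n_high.
have /and4P[/= gaa sa sa' _] := psP _ (mem_head _ _).
have psP' p : p \in ps -> [&& G p.1 p.2, ~~ usd p.1, usd p.2 & connect G a p.1].
  by move=> pps; apply: psP; rewrite inE pps orbT.
have [P [P' [PV PV' P0 dP dP']]] := min_degree_pair H_sym (cV a) (cV a') ds dense.
case/card_gt0P: P0 => w wP.
have [|W WN cW] := @subset_of_card _ [set y in P' | H w y] e.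
  by have := dP w wP; card_lia.
have WP' : W \subset P' by apply: subset_trans WN _; apply/subsetP=> y; rewrite inE => /andP[].
have reach : {in W, forall y, reaches w (w |: W) 1 (1 + 2 * e) y}.
  move=> y yW; have := subsetP WN y yW; rewrite inE => /andP[yP wy].
  exists [:: y]; split=> //=.
  - by rewrite wy.
  - rewrite inE andbT; apply/eqP=> E; have := bip _ _ wy.
    by rewrite -E; case: (side w).
  - by move=> x; rewrite !inE => /orP[/eqP ->|/eqP ->]; rewrite ?eqxx // yW orbT.
have cX0 v : #|(w |: W) :&: V v| <= e + 1.
  apply: leq_trans (_ : #|w |: W| <= _); first by rewrite subset_leq_card ?subsetIl.
  by rewrite cardsU1 cW addnC leq_add2l leq_b1.
case/andP: u1 => na1 u1; case/andP: u2 => na2 u2.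
have a_out : a \notin unzip1 ps ++ unzip2 ps.
  rewrite mem_cat negb_or na1; apply/negP=> /mapP[p /psP'/and4P[_ _ sp _] E].
  by move: sa; rewrite E sp.
have a'_out : a' \notin unzip1 ps ++ unzip2 ps.
  rewrite mem_cat negb_or na2 andbT; apply/negP=> /mapP[p /psP'/and4P[_ sp _ _] E].
  by move: sp; rewrite -E sa'.
(* The toured path may exceed its nominal length by 2e, and the link back has fewer than [K] edges;
   [L] leaves room for both and for the closing. *)
pose L := 2 * n - 4 - 2 * e - K.
have [|||||X' [b' [W' [u' [[WV' eW' reach' us' ru'] /andP[b'L Lb'] Xm Xo]]]]] :=
  @tour ps usd a w l (size ps) L psP' u1 u2 psl el (w |: W) 1 W a' 0 (subset_trans WP' PV')
    (eq_leq (esym cW)) reach sa' (connect1 gaa).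
- by move=> v; apply: leq_trans (cX0 v) _; move: el e_gt0; card_lia.
- move=> v vps; rewrite leqn0 cards_eq0; apply/eqP/setP=> x; rewrite !inE.
  apply/negP=> /andP[/orP[/eqP ->|xW] xv].
    by move: vps; rewrite -(dV (subsetP PV _ wP) xv); apply/negP.
  by move: vps; rewrite -(dV (subsetP PV' _ (subsetP WP' _ xW)) xv); apply/negP.
- by [].
- by rewrite /L; move: n_low; card_lia.
- by rewrite /L; move: (_ * (2 * _)) n_high => z; card_lia.
have cXP v (Q : {set T}) : v \notin unzip1 ps ++ unzip2 ps -> Q \subset V v ->
    #|X' :&: Q| <= e + 1 + size ps.
  move=> vo QV; apply: leq_trans (_ : #|X' :&: V v| <= _).
    by rewrite subset_leq_card // setIS.
  by apply: leq_trans (Xo v vo) _; rewrite leq_add2r.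
have ua : u' != a by apply: contraTneq us' => ->.
have [pth [gp up lastp]] : exists pth : seq U, [/\ path G u' pth, uniq (u' :: pth) & last u' pth = a].
  have /connectP[pth0 gp0 last0] : connect G u' a by rewrite (sym_connect_sym G_sym).
  by case/shortenP: gp0 last0 => pth gp up _ ->; exists pth.
have spth : size pth < K by rewrite -card_U; have := max_card (mem (u' :: pth)); rewrite (card_uniqP up).
have cD v : #|V v :\: X'| + #|X' :&: V v| = s by rewrite -(cV v) -(cardsID X' (V v)) setIC addnC.
have degP : d <= #|P|.
  have [y yW] : exists y, y \in W by apply/card_gt0P; rewrite cW.
  apply: leq_trans (dP' y (subsetP WP' y yW)) _; apply: subset_leq_card.
  by apply/subsetP=> x; rewrite inE => /andP[].
have [||||x [ys [z [xW pxz zP al2 ysX]]]] :=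
    link_exists (F := X') gp _ WV' eW' (Z := P :\: X').
- by case: (pth) lastp ua => //= ->; rewrite eqxx.
- by rewrite lastp; apply: subset_trans PV; apply: subsetDl.
- by have := cXP a P a_out PV; have := cardsID X' P; rewrite setIC; card_lia.
- by move=> v _; have := cD v; have := Xm v; card_lia.
have [uxs cxs] := transversal_uniq al2 (proj2 (andP up)).
have sxs : size (rcons ys z) = size pth by move: al2; rewrite all2E => /andP[/eqP].
have [p [pw lastw uwp pX /andP[lop hip]]] := reach' x xW.
have [zX zP1] : z \notin X' /\ z \in P by move: zP; rewrite inE => /andP[].
pose q0 := p ++ rcons ys z.
have pq0 : path H w q0 by rewrite cat_path pw lastw.
have last_q0 : last w q0 = z by rewrite last_cat last_rcons.
have xs_X t : t \in rcons ys z -> t \notin X'.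
  by rewrite mem_rcons inE => /orP[/eqP ->|/ysX].
have uq0 : uniq (w :: q0).
  rewrite -cat_cons cat_uniq uwp uxs andbT /=; apply/hasPn=> t /xs_X.
  by apply: contra => /pX.
have sq0 : size q0 = size p + size pth by rewrite size_cat sxs.
have even_q0 : ~~ odd (size q0).
  have := path_parity bip pq0; rewrite last_q0 (sideV a z) ?(subsetP PV) //.
  by rewrite (sideV a w) ?(subsetP PV) //; case: (usd a); case: (odd _).
pose X1 := X' :|: [set t in rcons ys z].
have q0X t : t \in w :: q0 -> t \in X1.
  rewrite -cat_cons mem_cat => /orP[/pX tX|tt]; first by rewrite inE tX.
  by rewrite !inE tt orbT.
have cX1 v (Q : {set T}) : v \notin unzip1 ps ++ unzip2 ps -> Q \subset V v ->
    #|X1 :&: Q| <= e + size ps + 2.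
  move=> vo QV; have := cXP v Q vo QV.
  have : #|[set t in rcons ys z] :&: Q| <= 1.
    by apply: leq_trans (cxs v); rewrite subset_leq_card // setIS.
  by rewrite setIUl; have := (leq_card_setU (X' :&: Q) ([set t in rcons ys z] :&: Q)).1; card_lia.
have cX1P := cX1 a P a_out PV; have cX1P' := cX1 a' P' a'_out PV'.
(* The 3 stands for [w] and the closing vertices [y], [y']. As [q0] joins two vertices of one side,
   its length is even and [t] is odd, so the greedy path ends in [P']. *)
pose t := 2 * n - 3 - size q0.
have t_high : t <= 6 * e + 2 * K + 5.
  by rewrite /t sq0; move: Lb' lop; rewrite /L; card_lia.
have t_sum : size q0 + t + 3 = 2 * n.
  by rewrite /t sq0; move: b'L hip spth n_low; rewrite /L; card_lia.
have odd_t : odd t.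
  have := congr1 odd t_sum; rewrite mul2n odd_double !oddD /=.
  by move: even_q0; case: (odd (size q0)); case: (odd t).
have [||p1 [pp1 sp1 up1 p1X]] := greedy_path (f := 0) (X := X1) (t := t) dP dP' zP1.
- by move: cX1P t_high ed; card_lia.
- by move: cX1P' t_high ed; card_lia.
rewrite odd_t; set w' := last z p1 => w'P.
pose X2 := X1 :|: [set t in p1].
have cX2 (Q : {set T}) : #|X1 :&: Q| <= e + size ps + 2 -> #|X2 :&: Q| <= e + size ps + 2 + t.
  have : #|[set t in p1] :&: Q| <= t.
    by apply: leq_trans (subset_leq_card (subsetIl _ _)) _; rewrite cardsE -sp1 card_size.
  by rewrite /X2 (setIUl X1); have := (leq_card_setU (X1 :&: Q) ([set t in p1] :&: Q)).1; card_lia.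
pose N' := [set x in P | H w' x] :\: X2.
pose N := [set y in P' | H w y] :\: X2.
have eN' : e <= #|N'|.
  have := cX2 P cX1P; have := dP' w' w'P; have := cardsID X2 [set x in P | H w' x].
  have : #|[set x in P | H w' x] :&: X2| <= #|X2 :&: P|.
    by apply: subset_leq_card; apply/subsetP=> y; rewrite !inE => /andP[/andP[-> _] ->].
  by rewrite /N'; move: t_high ed; card_lia.
have eN : e <= #|N|.
  have := cX2 P' cX1P'; have := dP w wP; have := cardsID X2 [set x in P' | H w x].
  have : #|[set x in P' | H w x] :&: X2| <= #|X2 :&: P'|.
    by apply: subset_leq_card; apply/subsetP=> y; rewrite !inE => /andP[/andP[-> _] ->].
  by rewrite /N; move: t_high ed; card_lia.
have [||y [y' [yN yN' yy']]] := V_holes gaa _ _ eN' eN.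
- by apply: subset_trans PV; apply/subsetP=> y; rewrite !inE => /andP[_ /andP[]].
- by apply: subset_trans PV'; apply/subsetP=> y; rewrite !inE => /andP[_ /andP[]].
have [yX w'y] : y \notin X2 /\ H w' y by move: yN; rewrite !inE => /andP[? /andP[_ ?]].
have [yX' wy'] : y' \notin X2 /\ H w y' by move: yN'; rewrite !inE => /andP[? /andP[_ ?]].
exists ((w :: q0) ++ p1 ++ [:: y; y']); split.
- by rewrite !size_cat sp1 -t_sum /=; card_lia.
- have yne : y != y' by apply/eqP=> E; have := bip _ _ yy'; rewrite E; case: (side y').
  have uyy : uniq [:: y; y'] by rewrite /= inE yne.
  rewrite cat_uniq uq0 cat_uniq up1 uyy !andTb andbT; apply/andP; split.
    apply/hasPn=> x'; rewrite mem_cat => /orP[/p1X|]; first by apply: contra => /q0X.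
    rewrite !inE => /orP[/eqP ->|/eqP ->].
      by apply: contra yX => /q0X yy; rewrite inE yy.
    by apply: contra yX' => /q0X yy; rewrite inE yy.
  apply/hasPn=> x'; rewrite !inE => /orP[/eqP ->|/eqP ->].
    by apply: contra yX => yy; rewrite !inE yy orbT.
  by apply: contra yX' => yy; rewrite !inE yy orbT.
rewrite /cycle /= rcons_cat cat_path pq0 last_q0 rcons_cat cat_path pp1 -/w' /=.
by rewrite w'y yy' H_sym wy'.
Qed.
End Cycle.

(** * Monochromatic cycles from the reduced graph *)

Lemma connected_matching_exists (V : finType) (side : pred V) (g : 'I_4 -> rel V)
    (k h q : nat) (bad : {set V}) :
  (forall c, symmetric (g c)) -> (forall c u v, g c u v -> side v = ~~ side u) ->
  (forall b, #|[set v | side v == b]| = k) -> #|bad| <= 2 * h ->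
  (forall v, v \notin bad ->
     #|[set w | (side w == ~~ side v) && ~~ [exists c, g c v w]]| <= h) ->
  5 * q + 9 * h < k ->
  exists c (M : {set V * V}) u, [/\ bimatching M, q < #|M| &
    {in M, forall e, [&& ~~ side e.1, g c e.1 e.2 & connect (g c) u e.1]}].
Proof.
move=> g_sym g_side card_side card_bad good_deg; rewrite ltnNge => big.
pose bim (M : {set V * V}) := [forall e in M, forall f in M,
  ((e.1 == f.1) || (e.2 == f.2)) ==> (e == f)].
have bimP M : reflect (bimatching M) (bim M).
  apply: (iffP forall_inP) => [hM e f eM fM ef|hM e eM].
    by apply/eqP; apply: (implyP (forall_inP (hM e eM) f fM)).
  by apply/forall_inP=> f fM; apply/implyP=> ef; apply/eqP/hM.
pose ok c M u := [&& bim M, q < #|M| &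
  [forall e in M, [&& ~~ side e.1, g c e.1 e.2 & connect (g c) u e.1]]].
have [/existsP[c /existsP[M /existsP[u /and3P[mM qM /forall_inP cM]]]]|no] :=
  boolP [exists c, exists M, exists u, ok c M u].
  by exists c, M, u; split=> //; apply/bimP.
case/negP: big; apply: (connected_matching_bound g_sym g_side card_side card_bad good_deg).
move=> c M u /bimP mM cM; rewrite leqNgt; apply: contra no => qM.
apply/existsP; exists c; apply/existsP; exists M; apply/existsP; exists u.
by rewrite /ok mM qM; apply/forall_inP.
Qed.

Lemma card_clusters (X I : finType) (A : I -> {set X}) s : clusters A s -> #|I| * s <= #|X|.
Proof.
move=> [cA dA]; apply: leq_trans (max_card (mem (\bigcup_i A i))).
rewrite -sum1_card partition_disjoint_bigcup //.
by rewrite (eq_bigr (fun=> s)) ?sum_nat_const // => i _; rewrite sum1_card cA.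
Qed.

(** Otherwise h + 1 rows with at least h + 1 elements each would give (h + 1)^2 elements. *)
Lemma few_heavy_rows (J : finType) (un : {set J * J}) h p :
  p * #|un| <= #|J| ^ 2 -> #|J| ^ 2 < p * h.+1 ^ 2 ->
  #|[set i | h < #|[set j | (i, j) \in un]|]| <= h.
Proof.
move=> pun ph; set hv := [set i | _]; rewrite leqNgt; apply/negP=> lt.
have : h.+1 * #|hv| <= #|un|.
  rewrite mulnC -sum_nat_const.
  apply: leq_trans (_ : \sum_(i in hv) #|[set j | (i, j) \in un]| <= _).
    by apply: leq_sum => i; rewrite inE.
  have -> : #|un| = \sum_i #|[set j | (i, j) \in un]|.
    rewrite (eq_bigr (fun i => \sum_(j | (i, j) \in un) 1)); last by move=> i _; rewrite sum1dep_card.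
    by rewrite (pair_big_dep predT (fun i j => (i, j) \in un) (fun _ _ => 1)) sum1dep_card; apply: eq_card => -[i j]; rewrite !inE.
  by rewrite [X in _ <= X](bigID (mem hv)) leq_addr.
move=> h1; have h2 : h.+1 ^ 2 <= #|un|.
  by apply: leq_trans h1; rewrite leq_mul2l.
by have := leq_trans (leq_mul (leqnn p) h2) pun; rewrite leqNgt ph.
Qed.

Lemma colour_class_sym k N (c : 'I_N -> 'I_N -> 'I_k) a : symmetric (colour_class c a).
Proof. by move=> [x|x] [y|y]. Qed.

Definition right_side (X Y : Type) (u : X + Y) := if u is inr _ then true else false.

Section Cycles.
Variables (N : nat) (c : 'I_N -> 'I_N -> 'I_4) (J : finType) (A B : J -> {set 'I_N}).
Variables (s p e : nat).
Hypothesis A_clusters : clusters A s.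
Hypothesis B_clusters : clusters B s.
Hypothesis s_gt0 : 0 < s.
Hypothesis s_le : s <= p * e.

Let weight i j a := \sum_(x in A i) \sum_(y in B j) (c x y == a : nat).
(** The majority colour carries at least a quarter of the edges of the pair, which the closing pair
    needs; [ord0] is only the seed of the maximum. *)
Let major i j := [arg max_(a > ord0) weight i j a].

Let dense_major i j : s ^ 2 <= 4 * weight i j (major i j).
Proof.
rewrite /major; case: arg_maxnP => // a _ maxa.
have -> : s ^ 2 = \sum_b weight i j b.
  rewrite exchange_big /= (eq_bigr (fun=> s)) ?sum_nat_const ?A_clusters.1 ?mulnn // => x _.
  rewrite exchange_big /= (eq_bigr (fun=> 1)) ?sum1_card ?B_clusters.1 // => y _.
  by rewrite (bigD1 (c x y)) //= eqxx big1 // => b; rewrite eq_sym => /negbTE ->.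
apply: leq_trans (_ : \sum_(b < 4) weight i j a <= _).
  by apply: leq_sum => b _; apply: maxa.
by rewrite sum_nat_const card_ord.
Qed.

Definition reduced a : rel (J + J) := fun u v =>
  match u, v with
  | inl i, inr j | inr j, inl i => stable_pair c p (A i) (B j) && (major i j == a)
  | _, _ => false
  end.

Definition lifted (u : J + J) : {set 'I_N + 'I_N} :=
  match u with inl i => [set inl x | x in A i] | inr j => [set inr y | y in B j] end.

Lemma lifted_clusters : clusters lifted s.
Proof.
split=> [[i|j]|[i|i] [j|j] ne] /=.
- by rewrite card_imset ?A_clusters.1 //; apply: inl_inj.
- by rewrite card_imset ?B_clusters.1 //; apply: inr_inj.
- rewrite -setI_eq0; apply/eqP/setP=> x; rewrite !inE; apply/negP=> /andP[].
  move=> /imsetP[y yi ->] /imsetP[z zj [yz]].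
  by rewrite -yz (disjointFr (A_clusters.2 i j _) yi) in zj.
- by rewrite -setI_eq0; apply/eqP/setP=> x; rewrite !inE; apply/negP=> /andP[/imsetP[y _ ->] /imsetP[]].
- by rewrite -setI_eq0; apply/eqP/setP=> x; rewrite !inE; apply/negP=> /andP[/imsetP[y _ ->] /imsetP[]].
- rewrite -setI_eq0; apply/eqP/setP=> x; rewrite !inE; apply/negP=> /andP[].
  move=> /imsetP[y yi ->] /imsetP[z zj [yz]].
  by rewrite -yz (disjointFr (B_clusters.2 i j _) yi) in zj.
Qed.

Lemma major_present i j : major i j \in colours_on c (A i) (B j).
Proof.
apply/negPn/negP=> no.
have : weight i j (major i j) = 0.
  rewrite /weight big1 // => x xA; rewrite big1 // => y yB.
  by case: eqP => // E; case/negP: no; apply/colours_onP; exists x, y.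
by move=> w0; have := dense_major i j; rewrite w0 muln0 leqn0 expn_eq0 /= (gtn_eqF s_gt0).
Qed.

(** As s <= pe, sets of size [e] fill a 1/p share of their clusters, so stability applies to the
    majority colour, which occurs in the pair. *)
Lemma reduced_no_holes a u v : reduced a u v -> no_holes (colour_class c a) e (lifted u) (lifted v).
Proof.
have main i j (Z Z' : {set 'I_N + 'I_N}) : reduced a (inl i) (inr j) ->
    Z \subset lifted (inl i) -> Z' \subset lifted (inr j) -> e <= #|Z| -> e <= #|Z'| ->
    exists x y, [/\ inl x \in Z, inr y \in Z' & c x y == a].
  move=> /andP[st /eqP mj] ZA ZB eZ eZ'.
  pose S := [set x | inl x \in Z]; pose S' := [set y | inr y \in Z'].
  have ZE : Z = [set inl x | x in S].
    apply/setP=> z; apply/idP/imsetP=> [zZ|[x + ->]]; last by rewrite inE.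
    have /imsetP[x _ zx] := subsetP ZA z zZ.
    by exists x; rewrite // inE -zx.
  have ZE' : Z' = [set inr x | x in S'].
    apply/setP=> z; apply/idP/imsetP=> [zZ|[x + ->]]; last by rewrite inE.
    have /imsetP[x _ zx] := subsetP ZB z zZ.
    by exists x; rewrite // inE -zx.
  have cS : #|S| = #|Z| by rewrite ZE card_imset //; apply: inl_inj.
  have cS' : #|S'| = #|Z'| by rewrite ZE' card_imset //; apply: inr_inj.
  have := forallP (forallP (forall_inP st a _) S) S'; rewrite -{1}mj.
  move=> /(_ (major_present i j)); rewrite A_clusters.1 B_clusters.1.
  have -> : S \subset A i.
    apply/subsetP=> x; rewrite inE => /(subsetP ZA)/imsetP[y yA [->]]; exact: yA.
  have -> : S' \subset B j.
    apply/subsetP=> x; rewrite inE => /(subsetP ZB)/imsetP[y yA [->]]; exact: yA.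
  have -> : s <= p * #|S| by apply: leq_trans s_le _; rewrite leq_mul2l cS eZ orbT.
  have -> : s <= p * #|S'| by apply: leq_trans s_le _; rewrite leq_mul2l cS' eZ' orbT.
  move=> /colours_onP[x [y [xS yS cxy]]]; exists x, y; split; last by rewrite cxy.
    by move: xS; rewrite inE.
  by move: yS; rewrite inE.
case: u v => [i|j] [i'|j'] // red Z Z' ZA ZB eZ eZ'.
  have [x [y [xZ yZ cxy]]] := main i j' Z Z' red ZA ZB eZ eZ'.
  by exists (inl x), (inr y).
have [x [y [xZ yZ cxy]]] := main i' j Z' Z red ZB ZA eZ' eZ.
by exists (inr y), (inl x).
Qed.

Lemma monochromatic_cycle k h q l d n :
  #|J| = k -> 0 < e -> p * #|unstable c p A B| <= k ^ 2 -> k ^ 2 < p * h.+1 ^ 2 ->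
  5 * q + 9 * h < k -> 8 * d < s -> 10 * e + 4 * k + q + 10 <= d ->
  q + l + 3 * e <= s -> 2 * e <= l -> 2 * e + 2 * k + 6 <= 2 * n -> n <= q * (l - 2 * e) ->
  exists a q, [/\ size q = 2 * n, uniq q & cycle (colour_class c a) q].
Proof.
move=> cJ e0 pun ph qk ds ed ql el nlow nhigh.
pose side (u : J + J) := right_side u.
pose nonadj v := [set w | (side w == ~~ side v) && ~~ [exists a, reduced a v w]].
pose bad := [set v | h < #|nonadj v|].
have red_ex i j : [exists a, reduced a (inl i) (inr j)] = stable_pair c p (A i) (B j).
  apply/existsP/idP=> [[a /andP[]]//|st]; exists (major i j).
  by rewrite /= st eqxx.
have red_ex' i j : [exists a, reduced a (inr j) (inl i)] = stable_pair c p (A i) (B j).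
  by rewrite -red_ex; apply: eq_existsb.
have card_side b : #|[set v | side v == b]| = k.
  case: b.
    rewrite -cJ -(card_imset _ (@inr_inj J J)); apply: eq_card => -[i|i]; rewrite !inE /=.
      by apply/esym/imsetP=> -[].
    by apply/esym/imsetP; exists i.
  rewrite -cJ -(card_imset _ (@inl_inj J J)); apply: eq_card => -[i|i]; rewrite !inE /=.
    by apply/esym/imsetP; exists i.
  by apply/esym/imsetP=> -[].
have card_bad : #|bad| <= 2 * h.
  (* Bad vertices on the first side are heavy rows of the unstable pairs; those on the second side
     are heavy rows of the transpose. *)
  pose un := unstable c p A B; pose un' := [set ij | (ij.2, ij.1) \in un].
  have cun' : #|un'| = #|un|.
    rewrite -(card_imset (mem un) (f := fun ij => (ij.2, ij.1))); last by move=> [? ?] [? ?] [-> ->].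
    apply: eq_card => -[i j]; rewrite !inE /=; apply/idP/imsetP=> [st|[[i' j'] + [-> ->]]].
      by exists (j, i); rewrite // !inE.
    by rewrite !inE.
  have hl := few_heavy_rows (J := J) (un := un) (h := h) (p := p).
  have hr := few_heavy_rows (J := J) (un := un') (h := h) (p := p).
  rewrite cJ in hl hr; rewrite cun' in hr.
  have {}hl := hl pun ph; have {}hr := hr pun ph.
  rewrite mul2n -addnn; apply: leq_trans (leq_add hl hr).
  rewrite -(card_imset _ (@inl_inj J J)) -[X in _ + X](card_imset _ (@inr_inj J J)).
  apply: leq_trans (_ : #|[set inl x | x in [set i | h < #|[set j | (i, j) \in un]|]] :|:
     [set inr x | x in [set i | h < #|[set j | (i, j) \in un']|]]| <= _); last by rewrite (leq_card_setU _ _).1.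
  apply: subset_leq_card; apply/subsetP=> -[i|i]; rewrite !inE => hi; apply/orP; [left|right].
    apply/imsetP; exists i; rewrite // inE; apply: leq_trans hi _.
    rewrite -(card_imset _ (@inr_inj J J)); apply: subset_leq_card; apply/subsetP=> -[j|j]; rewrite !inE //=.
    by rewrite red_ex => ns; apply/imsetP; exists j; rewrite // !inE.
  apply/imsetP; exists i; rewrite // inE; apply: leq_trans hi _.
  rewrite -(card_imset _ (@inl_inj J J)); apply: subset_leq_card; apply/subsetP=> -[j|j]; rewrite !inE //=.
  by rewrite red_ex' => ns; apply/imsetP; exists j; rewrite // !inE.
have red_sym a : symmetric (reduced a) by move=> [i|i] [j|j].
have red_side a u v : reduced a u v -> side v = ~~ side u by case: u v => [i|i] [j|j].
have good_deg v : v \notin bad -> #|nonadj v| <= h by rewrite inE -leqNgt.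
have [a [M [u [mM qM Mok]]]] :=
  connected_matching_exists red_sym red_side card_side card_bad good_deg qk.
(* One matching edge is reserved for closing the cycle; the other [q] provide its length. *)
pose ms := take q.+1 (enum M).
have sms : size ms = q.+1 by rewrite size_takel // -cardE.
have msM z : z \in ms -> z \in M by move/mem_take; rewrite mem_enum.
have ums : uniq ms by rewrite take_uniq // enum_uniq.
have u1 : uniq (unzip1 ms).
  rewrite map_inj_in_uniq // => z z' /msM zM /msM zM' E.
  by apply: mM => //; rewrite E eqxx.
have u2 : uniq (unzip2 ms).
  rewrite map_inj_in_uniq // => z z' /msM zM /msM zM' E.
  by apply: mM => //; rewrite E eqxx orbT.
case: ms => [|[b b'] ps] // in sms msM u1 u2 ums *.
case: sms => sps.
have conn z : z \in (b, b') :: ps -> [&& reduced a z.1 z.2, ~~ side z.1, side z.2 & connect (reduced a) b z.1].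
  move=> zms; have /and3P[s1 r1 c1] := Mok z (msM z zms).
  have /and3P[_ _ c0] := Mok _ (msM _ (mem_head _ _)).
  rewrite r1 s1 (red_side _ _ _ r1) s1 /=; apply: connect_trans c1.
  by rewrite (sym_connect_sym (red_sym a)).
exists a; have /and4P[/= rb sb sb' _] := conn _ (mem_head _ _).
have cU : #|{: J + J}| = 2 * k by rewrite card_sum cJ addnn mul2n.
apply: (@cycle_of_length _ _ (colour_class c a) (reduced a) lifted s e (2 * k)
  (@colour_class_sym _ _ c a) (red_sym a) lifted_clusters (@reduced_no_holes a) e0 cU
  (fun x => right_side x) side ps b b' l d n).
- by move=> [x|x] [y|y].
- by move=> [i|i] x /imsetP[y _ ->].
- exact: conn.
- exact: u1.
- exact: u2.
- case: b b' rb sb sb' {u1 u2 conn ums msM} => [i|i] [j|j] //= /andP[_ /eqP <-] _ _.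
  apply: leq_trans (dense_major i j) _; rewrite leq_mul2l /=.
  rewrite big_imset /=; last by move=> ? ? _ _; apply: inl_inj.
  apply: eq_leq; apply: eq_bigr => x _.
  by rewrite big_imset //= => ? ? _ _; apply: inr_inj.
- exact: ds.
- by rewrite sps; move: ed; card_lia.
- by rewrite sps.
- exact: el.
- by move: nlow; card_lia.
- by rewrite sps mulnCA leq_mul2l nhigh orbT.
Qed.
End Cycles.

(** * The asymptotic upper bound for cycles *)

Lemma cycle_copy (W : finType) (G : rel W) (q : seq W) m :
  0 < m -> symmetric G -> size q = m -> uniq q -> cycle G q -> has_copy (@cycle_graph m) G.
Proof.
move=> m0 symG sq; rewrite -{m}sq in m0 *; case: q m0 => [//|w p] _ uq cq.
have next i : i < size (w :: p) ->
    G (nth w (w :: p) i) (nth w (w :: p) (i.+1 %% size (w :: p))).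
  move=> /= ip; have := pathP w cq i; rewrite size_rcons => /(_ ip).
  rewrite -rcons_cons nth_rcons ip nth_rcons.
  have [lt|ge|eq] := ltngtP i (size p).
  - by rewrite modn_small.
  - by move: ip; rewrite ltnS leqNgt ge.
  - by rewrite eq modnn.
exists (fun i : 'I_(size (w :: p)) => nth w (w :: p) i) => [i j /eqP|i j /orP[]/eqP <-].
- by rewrite nth_uniq // => /eqP/val_inj.
- exact: next.
- by rewrite symG; apply: next.
Qed.

(** Relative to ks/5, the product q(s - q - 5e) loses at most 15/(100r): 14/(100r) from [q] and
    1/(100r) from the clusters. The target [n] is below N/5 by the larger fraction 1/(5r + 1) >=
    1/(6r), and the difference pays for the [C] vertices outside the clusters. *)
Lemma upper_arith r k h q e s C n N :
  0 < r -> h * (100 * r) <= k -> k <= 5 * q + 9 * h + 5 -> 5 * q <= k -> 100 * r <= k ->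
  k <= C -> e * (1000 * r) <= s + 1000 * r -> (100 * 100) * r * (C + 20) <= s ->
  N <= k * s + C -> (5 * r + 1) * n <= r * N -> k * s <= N -> N <= 6 * n ->
  [/\ 10 * e + 4 * k + q + 10 <= (s - 1) %/ 8, q + 5 * e <= s, 2 * e + 2 * k + 6 <= 2 * n
    & n <= q * (s - q - 5 * e)].
Proof.
move=> r0 ht kq qk rk kC es sC Nk nN kN N6.
have rk' : 100 <= k by apply: leq_trans rk; rewrite leq_pmulr.
have e1 : 1000 * e <= s + 1000.
  have [//|lt] := leqP (1000 * e) (s + 1000).
  have : s < 1000 * (e - 1) by lia.
  have : 1000 * (e - 1) <= r * (1000 * (e - 1)) by rewrite leq_pmull.
  move: es; rewrite mulnBr muln1 mulnBr; nia.
have sC' : (100 * 100) * (C + 20) <= s.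
  by apply: leq_trans sC; rewrite [leqRHS]mulnAC leq_pmulr.
have ks100 : 100 * s <= k * s by rewrite leq_mul2r rk' orbT.
split; first by rewrite leq_divRL //; lia.
- by lia.
- by lia.
have le5 : 100 * r * (q + 5 * e) <= s.
  have a1 : 100 * r * q <= r * (20 * C).
    have : r * (20 * (5 * q)) <= r * (20 * C) by rewrite !leq_mul2l (leq_trans qk kC) !orbT.
    by move=> a0; apply: leq_trans a0; apply: eq_leq; clear; lia.
  have a2 : 100 * r * (5 * e) * 2 <= s + 1000 * r by lia.
  have a3 : (100 * 100) * r * (C + 20) = r * (20 * C) * 500 + (2000 * 100) * r by lia.
  by move: a1 a2 a3 sC; clear; lia.
pose Y := s - q - 5 * e.
have YE : Y + (q + 5 * e) = s by rewrite /Y; lia.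
have stepB : (100 * r - 1) * s <= 100 * r * Y.
  rewrite mulnBl mul1n leq_subLR -{1}YE mulnDr addnC leq_add2r //.
(* 14 = 9 + 5: the term 9h costs 9k after scaling by 100r, and the rounding term 5 costs 500r <=
   5k. *)
have stepA : (100 * r - 14) * k <= 500 * r * q.
  have : 100 * r * k <= 100 * r * (5 * q + 9 * h + 5) by rewrite leq_mul2l kq orbT.
  by rewrite mulnBl leq_subLR; move: ht rk; clear; lia.
have stepC : (100 * r - 14) * k * ((100 * r - 1) * s) <= (500 * 100) * r ^ 2 * (q * Y).
  apply: leq_trans (leq_mul stepA stepB) _; apply: eq_leq.
  by rewrite expnS expn1; clear; lia.
have stepD : ((100 * 100) * r ^ 2 - 1500 * r) * (k * s) <= (500 * 100) * r ^ 2 * (q * Y).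
  apply: leq_trans stepC; rewrite mulnACA; rewrite leq_mul2r; apply/orP; right.
  have [x xE] : exists x, 100 * r = x + 14 by exists (100 * r - 14); move: r0; clear; lia.
  rewrite (_ : _ * r ^ 2 = (100 * r) * (100 * r)); last by rewrite expnS expn1; clear; lia.
  rewrite (_ : 1500 * r = 15 * (100 * r)); last by clear; lia.
  by rewrite xE; clear; lia.
have ksC : 50 * r * C <= k * s.
  have : 50 * r * C <= s by apply: leq_trans sC; clear; lia.
  by move/leq_trans; apply; apply: leq_trans ks100; rewrite leq_pmull.
have nE : (5 * r + 1) * n <= r * (k * s + C) by apply: leq_trans nN _; rewrite leq_mul2l Nk orbT.
rewrite -/Y -(leq_pmul2l (_ : 0 < (5 * r + 1) * ((500 * 100) * r ^ 2))); last first.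
  by rewrite muln_gt0 addn1 muln_gt0 expn_gt0 r0.
apply: leq_trans (_ : (5 * r + 1) * (((100 * 100) * r ^ 2 - 1500 * r) * (k * s)) <= _); last first.
  by rewrite -[leqRHS]mulnA leq_mul2l stepD orbT.
apply: leq_trans (_ : (500 * 100) * r ^ 2 * (r * (k * s + C)) <= _).
  by rewrite [(5 * r + 1) * _]mulnC -mulnA leq_mul2l nE orbT.
move: ksC; move: (k * s) => z zC.
have b1 : 1500 * r <= (100 * 100) * r ^ 2 by rewrite expnS expn1; have : r <= r * r; [rewrite leq_pmulr | clear; lia].
have b2 : (500 * 100) * (r * r * r) + 1000 * (r * r) <= (5 * r + 1) * ((100 * 100) * r ^ 2 - 1500 * r).
  pose D := (100 * 100) * r ^ 2 - 1500 * r.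
  have DE : D + 1500 * r = (100 * 100) * (r * r) by rewrite /D subnK // expnS expn1.
  have rDE := congr1 (muln r) DE; have rr : r <= r * r by rewrite leq_pmulr.
  by rewrite -/D; move: DE rDE rr; clearbody D; clear; lia.
rewrite [leqRHS]mulnA; apply: leq_trans (leq_mul b2 (leqnn z)).
have b3 : 1000 * (r * r) * (50 * r * C) <= 1000 * (r * r) * z by rewrite leq_mul2l zC orbT.
by move: b3; rewrite expnS expn1; clear; lia.
Qed.

Lemma cycle_upper_bound r : 0 < r -> exists n0, forall n N, n0 <= n ->
  (5 * r + 1) * n <= r * N -> N <= 6 * n -> bipartite_arrows 4 (@cycle_graph (2 * n)) N.
Proof.
move=> r0; pose t := 100 * r; pose p := t ^ 2.
have t0 : 0 < t by rewrite muln_gt0.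
have p0 : 0 < p by rewrite expn_gt0 t0.
have [C hC] := stable_clusters 4 p0 t0.
pose S0 := (100 * 100) * r * (C + 20).
exists (C + C * S0 + 1) => n N n0 rnN N6 c.
have nN : 5 * n <= N.
  rewrite -(leq_pmul2l r0); apply: leq_trans rnN; rewrite mulnA [r * 5]mulnC leq_mul2r.
  by rewrite leq_addr orbT.
have nN' : n <= N by apply: leq_trans nN; rewrite leq_pmull.
have CN : C <= N by move: n0 nN'; card_lia.
have [J [A [B [s [cA cB /andP[kJ JC] cov un]]]]] :=
  hC _ _ _ c N (card_ord 4) (card_ord N) (card_ord N) CN.
move: kJ JC cov un; set k := #|J| => tk kC cov un.
have kN : k * s <= N by rewrite -[N]card_ord; apply: card_clusters cA.
have S0s : S0 <= s.
  rewrite leqNgt; apply/negP=> lt; have : k * s <= C * S0 by apply: leq_mul => //; apply: ltnW.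
  by move: cov n0 nN'; card_lia.
(* With p = t^2 the unstable pairs leave at most k/t heavy rows; [q] is the largest value with 5q +
   9h < k. *)
pose e := (s %/ p).+1; pose h := k %/ t; pose q := (k - 9 * h - 1) %/ 5.
have ht : h * t <= k by apply: leq_trunc_div.
have h9 : 9 * h < k.
  have : h * 100 <= k by apply: leq_trans ht; rewrite leq_mul2l leq_pmulr ?orbT.
  have : 0 < k by apply: leq_trans tk.
  by card_lia.
have q5 : 5 * q <= k - 9 * h - 1 by rewrite mulnC leq_trunc_div.
have q5' : k - 9 * h - 1 < 5 * q + 5 by rewrite [5 * q]mulnC -mulSnr; apply: ltn_ceil.
have es : e * (1000 * r) <= s + 1000 * r.
  rewrite [e * _]mulSnr leq_add2r; apply: leq_trans (leq_trunc_div s p).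
  by rewrite leq_mul2l /p /t expnS expn1; apply/orP; right; have : r <= r * r; [rewrite leq_pmulr | clear; lia].
have kq : k <= 5 * q + 9 * h + 5 by move: q5' h9; card_lia.
have qk : 5 * q <= k by move: q5; card_lia.
have [a1 a2 a3 a4] := upper_arith r0 ht kq qk tk kC es S0s cov rnN kN N6.
have ph : k ^ 2 < p * h.+1 ^ 2.
  by rewrite /p -expnMn ltn_exp2r // mulnC; apply: ltn_ceil.
have sp : s <= p * e by rewrite mulnC ltnW // ltn_ceil.
have s0 : 0 < s by apply: leq_trans S0s; rewrite !muln_gt0 r0 addnS.
have d8 : 8 * ((s - 1) %/ 8) < s.
  by rewrite mulnC; have := leq_trunc_div (s - 1) 8; move: s0; card_lia.
have [||||a [cyc [sc uc cc]]] := @monochromatic_cycle N c J A B s p e cA cB s0 sp k h q (s - q - 3 * e)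
   ((s - 1) %/ 8) n (erefl _) (ltn0Sn _) un ph _ d8 a1 _ _ a3.
- by move: q5 h9; card_lia.
- by move: a2; card_lia.
- by move: a2; card_lia.
- by rewrite (_ : _ - 2 * e = s - q - 5 * e) //; card_lia.
exists a; apply: (cycle_copy _ (@colour_class_sym _ _ c a) sc uc cc).
by move: a3; rewrite muln_gt0 /=; card_lia.
Qed.

(** * Existence of the Ramsey numbers *)

Lemma large_fibre (X F : finType) (phi : X -> F) n :
  #|F| * n < #|X| -> exists f, n < #|[set x | phi x == f]|.
Proof.
move=> lt; have [/existsP[f ?]|/existsPn no] := boolP [exists f, n < #|[set x | phi x == f]|].
  by exists f.
move: lt; rewrite ltnNge => /negP[].
rewrite -cardsT -sum1_card (partition_big phi predT) //= -sum_nat_const.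
apply: leq_sum => f _; rewrite leqNgt; apply: contra (no f).
by rewrite sum1dep_card; congr (_ < _); apply: eq_card => x; rewrite !inE.
Qed.

(** Pigeonhole twice: [n] right vertices see 4n left vertices with the same colour vector, and [n]
    of these left vertices have one colour, which gives a monochromatic K_{n,n}. The cycle
    alternates in it according to parity. *)
Lemma cycle_arrows_exists n : 0 < n -> exists N, bipartite_arrows 4 (@cycle_graph (2 * n)) N.
Proof.
move=> n0; pose m := 4 * n; pose N := m + #|{ffun 'I_m -> 'I_4}| * n.
have mN : m <= N by apply: leq_addr.
exists N => c.
pose phi (y : 'I_N) := [ffun i : 'I_m => c (widen_ord mN i) y].
have m0 : 0 < m by rewrite muln_gt0.
have [v cY] : exists v, n < #|[set y | phi y == v]|.
  by apply: large_fibre; rewrite card_ord /N addnC -[X in X < _]addn0 ltn_add2l.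
have [a cX] : exists a, n.-1 < #|[set i | v i == a]|.
  by apply: large_fibre; rewrite !card_ord ltn_mul2l /= prednK.
rewrite prednK // in cX.
pose X := enum [set i | v i == a]; pose Y := enum [set y | phi y == v].
have sX : n <= size X by rewrite -cardE.
have sY : n <= size Y by rewrite -cardE ltnW.
pose al j := widen_ord mN (nth (Ordinal m0) X j).
pose be j := nth (widen_ord mN (Ordinal m0)) Y j.
have half_lt (x : 'I_(2 * n)) : x./2 < n by move: (ltn_ord x); move: (nat_of_ord x) => i; clear; lia.
have edge i j : i < n -> j < n -> c (al i) (be j) = a.
  move=> iln jln; have : nth (Ordinal m0) X i \in X by rewrite mem_nth // (leq_trans iln).
  have : be j \in Y by rewrite mem_nth // (leq_trans jln).
  by rewrite !mem_enum !inE => /eqP <- /eqP; rewrite ffunE.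
exists a; pose f (x : 'I_(2 * n)) : 'I_N + 'I_N := if odd x then inr (be x./2) else inl (al x./2).
have f_edge (x y : 'I_(2 * n)) : odd y = ~~ odd x -> colour_class c a (f x) (f y).
  by rewrite /f => ->; case: (odd x); rewrite /= edge.
exists f => [x y|x y].
  rewrite /f => E; apply: ord_inj; rewrite -(odd_double_half x) -(odd_double_half y).
  move: E; case: (odd x); case: (odd y) => // -[] E; congr (_ + _.*2); apply/eqP.
    by rewrite -(nth_uniq (widen_ord mN (Ordinal m0)) (leq_trans (half_lt x) sY) (leq_trans (half_lt y) sY) (enum_uniq _)) -/(be _) -/(be _) E.
  rewrite -(nth_uniq (Ordinal m0) (leq_trans (half_lt x) sX) (leq_trans (half_lt y) sX) (enum_uniq _)).
  by apply/eqP/val_inj; exact: E.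
have odd_succ (z : 'I_(2 * n)) : odd (ordS z) = ~~ odd z by rewrite /= odd_mod ?mul2n ?odd_double.
case/orP=> /eqP <-; first by apply: f_edge; apply: odd_succ.
by rewrite colour_class_sym; apply: f_edge; apply: odd_succ.
Qed.

Lemma path_of_cycle_arrows n N : 0 < n ->
  bipartite_arrows 4 (@cycle_graph n) N -> bipartite_arrows 4 (@path_graph n) N.
Proof.
move=> n0 arr c; have [a [f injf edge]] := arr c; exists a; exists f => // x y xy.
apply: edge; case/orP: xy => /eqP E; apply/orP; [left|right];
  by apply/eqP/ord_inj; rewrite /= E modn_small.
Qed.

(** * The lower bound *)

(* A 4-colouring of [K_{5,5}] in which every colour class is a star forest. *)
Definition star_colour (i j : nat) : nat := nth 0 (nth [::]
  [:: [:: 1; 1; 0; 0; 0]; [:: 0; 3; 3; 2; 1]; [:: 0; 2; 2; 3; 1];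
      [:: 2; 0; 1; 3; 2]; [:: 3; 0; 1; 2; 3]] i) j.

(* The centre of the star containing the edge [ij]; [true] marks the second side. *)
Definition star_centre (i j : nat) : bool * nat :=
  if all (fun j' => (star_colour i j' == star_colour i j) ==> (j' == j)) (iota 0 5)
  then (true, j) else (false, i).

(** With the column version this says that adjacent edges of one colour lie in one star, checked
    over all triples of indices. *)
Lemma star_centre_row i j j' : i < 5 -> j < 5 -> j' < 5 ->
  star_colour i j = star_colour i j' -> star_centre i j = star_centre i j'.
Proof.
have : all (fun i => all (fun j => all (fun j' =>
  (star_colour i j == star_colour i j') ==> (star_centre i j == star_centre i j'))
  (iota 0 5)) (iota 0 5)) (iota 0 5) by vm_compute.
move=> H hi hj hj' /eqP E; move/allP: H => /(_ i); rewrite mem_iota => /(_ hi).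
move=> /allP/(_ j); rewrite mem_iota => /(_ hj) /allP/(_ j'); rewrite mem_iota => /(_ hj').
by rewrite E => /eqP.
Qed.

Lemma star_centre_column i i' j : i < 5 -> i' < 5 -> j < 5 ->
  star_colour i j = star_colour i' j -> star_centre i j = star_centre i' j.
Proof.
have : all (fun i => all (fun j => all (fun i' =>
  (star_colour i j == star_colour i' j) ==> (star_centre i j == star_centre i' j))
  (iota 0 5)) (iota 0 5)) (iota 0 5) by vm_compute.
move=> H hi hi' hj /eqP E; move/allP: H => /(_ i); rewrite mem_iota => /(_ hi).
move=> /allP/(_ j); rewrite mem_iota => /(_ hj) /allP/(_ i'); rewrite mem_iota => /(_ hi').
by rewrite E => /eqP.
Qed.

Lemma star_colour_lt i j : i < 5 -> j < 5 -> star_colour i j < 4.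
Proof.
have : all (fun i => all (fun j => star_colour i j < 4) (iota 0 5)) (iota 0 5) by vm_compute.
move=> H hi hj; move/allP: H => /(_ i); rewrite mem_iota => /(_ hi).
by move=> /allP/(_ j); rewrite mem_iota => /(_ hj).
Qed.

(** All edges of a monochromatic path project to one star. Its [n] disjoint edges at even positions
    each have a vertex in the block of the centre, but a block has at most n - 1 vertices. *)
Lemma path_lower_bound n M : 0 < n -> bipartite_arrows 4 (@path_graph (2 * n)) M -> 5 * n < M + 5.
Proof.
move=> n0 arr; rewrite ltnNge; apply/negP=> le.
pose m := n.-1; have mn : m.+1 = n by rewrite /m prednK.
have M5 : M <= 5 * m by move: le; rewrite -mn mulnSr leq_add2r.
pose blk (x : 'I_M) : nat := x %/ m.
(* For n = 1 the block size is 0, but then M = 0 as well; positivity therefore comes from a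
   vertex. *)
have m0 (x : 'I_M) : 0 < m.
  by have := leq_trans (ltn_ord x) M5; case: (m) => //; rewrite muln0.
have blk5 x : blk x < 5 by rewrite ltn_divLR ?(m0 x) // (leq_trans (ltn_ord x)).
have [a [f injf edge]] := arr (fun x y => inord (star_colour (blk x) (blk y))).
set cc := (fun x y => _) in edge.
have ccE x y x' y' : cc x y = cc x' y' ->
    star_colour (blk x) (blk y) = star_colour (blk x') (blk y').
  by move=> /(congr1 (@nat_of_ord 4)); rewrite /cc !inordK ?star_colour_lt.
pose cen (u v : 'I_M + 'I_M) := match u, v with
  | inl x, inr y | inr y, inl x => star_centre (blk x) (blk y) | _, _ => (false, 0) end.
have cen_share u v w : colour_class cc a u v -> colour_class cc a v w -> cen u v = cen v w.
  case: u v w => [x|x] [y|y] [z|z] //= /eqP c1 /eqP c2.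
    by apply: star_centre_column => //; apply: ccE; rewrite c1.
  by apply: star_centre_row => //; apply: ccE; rewrite c1.
pose emb (b : bool) (x : 'I_M) : 'I_M + 'I_M := if b then inr x else inl x.
have cen_end u v : colour_class cc a u v ->
    exists2 x, blk x = (cen u v).2 & emb (cen u v).1 x = u \/ emb (cen u v).1 x = v.
  case: u v => [x|x] [y|y] //= _; rewrite /star_centre; case: ifP => _ /=.
  - by exists y => //; right.
  - by exists x => //; left.
  - by exists x => //; left.
  - by exists y => //; right.
have lt2 t : t < n -> 2 * t < 2 * n by rewrite ltn_mul2l.
have lt2' t : t < n -> (2 * t).+1 < 2 * n by move=> tn; rewrite -[X in _ < X]mulnC; lia.
pose vx t : 'I_M + 'I_M := if insub t is Some i then f i else f (Ordinal (lt2 0 n0)).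
have vxE t (h : t < 2 * n) : vx t = f (Ordinal h) by rewrite /vx insubT.
have step t : t.+1 < 2 * n -> colour_class cc a (vx t) (vx t.+1).
  by move=> h; rewrite (vxE _ (ltnW h)) (vxE _ h); apply: edge; rewrite /path_graph /= eqxx.
pose z := cen (vx 0) (vx 1).
have cen_const t : t.+1 < 2 * n -> cen (vx t) (vx t.+1) = z.
  elim: t => // t IH h; rewrite -IH ?(ltnW h) //.
  by apply/esym/cen_share; apply: step => //; apply: ltnW.
have pick (t : 'I_n) : exists x, blk x = z.2 /\
    (emb z.1 x = vx (2 * t) \/ emb z.1 x = vx (2 * t).+1).
  have h := lt2' t (ltn_ord t); have [x] := cen_end _ _ (step _ h).
  by rewrite (cen_const _ h); exists x.
have [g hg] := fin_all_exists pick.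
have vx_inj t t' : t < 2 * n -> t' < 2 * n -> vx t = vx t' -> t = t'.
  by move=> h h'; rewrite (vxE _ h) (vxE _ h') => /injf [].
have inj_g : injective g.
  move=> t t' E; have [_ h1] := hg t; have [_ h2] := hg t'; rewrite -E in h2.
  have same i i' : i < 2 * n -> i' < 2 * n -> emb z.1 (g t) = vx i -> emb z.1 (g t) = vx i' -> i = i'.
    by move=> hi hi' -> /vx_inj; apply.
  have := lt2 t (ltn_ord t); have := lt2' t (ltn_ord t).
  have := lt2 t' (ltn_ord t'); have := lt2' t' (ltn_ord t').
  move=> p1 p2 p3 p4; apply: ord_inj.
  case: h1 => h1; case: h2 => h2.
  - by have := same _ _ p4 p2 h1 h2; clear; lia.
  - by have := same _ _ p4 p1 h1 h2; clear; lia.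
  - by have := same _ _ p3 p2 h1 h2; clear; lia.
  - by have := same _ _ p3 p1 h1 h2; clear; lia.
suff : n <= m by rewrite -mn ltnn.
have mpos := m0 (g (Ordinal n0)).
(* Within one block a vertex is determined by its residue modulo [m]. *)
have rem_inj : injective (fun t => Ordinal (ltn_pmod (g t) mpos)).
  move=> t t' /(congr1 val) /= E; apply: inj_g; apply: ord_inj.
  have [b1 _] := hg t; have [b2 _] := hg t'.
  by rewrite (divn_eq (g t) m) (divn_eq (g t') m) E -/(blk _) -/(blk _) b1 b2.
by have := leq_card _ rem_inj; rewrite !card_ord.
Qed.

(** * The asymptotics *)

From HB Require Import structures.
From mathcomp Require Import all_order all_algebra.
From mathcomp Require Import all_classical all_reals all_analysis.
From mathcomp Require Import ring lra.

Import Order.TTheory GRing.Theory Num.Theory numFieldNormedType.Exports.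
Local Open Scope classical_set_scope.
Local Open Scope ring_scope.

Lemma least_nat (P : nat -> Prop) :
  (exists n, P n) -> exists n, P n /\ forall m, P m -> (n <= m)%N.
Proof.
move=> [n Pn]; have exP : exists n, `[< P n >] by exists n; apply/asboolP.
exists (ex_minn exP); case: ex_minnP => m /asboolP Pm minm; split=> // l Pl.
by apply: minm; apply/asboolP.
Qed.

Lemma cvg_ratio_sub5 (R : realType) (N : nat -> nat) :
  (forall r, (0 < r)%N -> exists n0, forall n, (n0 <= n)%N ->
     (5 * n < N n + 5)%N /\ (r * N n <= (5 * r + 1) * n + r)%N) ->
  (N n)%:R / n%:R - 5 @[n --> \oo] --> (0 : R).
Proof.
move=> bounds; apply/cvgrPdist_le => eps eps0.
(* The ratio deviates from 5 by at most 1/r + 1/n above and 5/n below; for n >= 5r both are at most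
   2/r. *)
have [r r0 reps] : exists2 r, (0 < r)%N & 2 <= eps * r%:R.
  exists (Num.truncn (2 / eps)).+1 => //.
  by rewrite mulrC -ler_pdivrMr // ltW // truncnS_gt.
have [n0 hn0] := bounds r r0.
near=> n; rewrite sub0r normrN.
have nn0 : (n0 <= n)%N by near: n; exact: nbhs_infty_ge.
have n_pos : (0 < n)%N by near: n; exact: nbhs_infty_gt.
have nR : 0 < n%:R :> R by rewrite ltr0n.
have n_large : 5 * r%:R <= n%:R :> R.
  by rewrite -natrM ler_nat; near: n; exact: nbhs_infty_ge.
have [lo hi] := hn0 n nn0.
have {lo} lo : 5 * n%:R <= (N n)%:R + 5 :> R by rewrite -natrM -natrD ler_nat ltnW.
have {hi} hi : r%:R * (N n)%:R <= (5 * r%:R + 1) * n%:R + r%:R :> R.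
  by rewrite -!natrM natr1 -natrM -natrD ler_nat -addn1.
have rR : 0 < r%:R :> R by rewrite ltr0n.
have r1 : 1 <= r%:R :> R by rewrite ler1n.
rewrite (_ : _ - 5 = ((N n)%:R - 5 * n%:R) / n%:R); last by field; rewrite gt_eqF.
rewrite normrM normfV (gtr0_norm nR) ler_pdivrMr // ler_norml.
rewrite -(ler_pM2l rR) -[X in _ && X](ler_pM2l rR).
have h1 : 2 * n%:R <= eps * r%:R * n%:R :> R by rewrite ler_pM2r.
by apply/andP; split; nra.
Unshelve. all: by end_near. Qed.

Theorem corollary2 (R : realType) :
  (exists2 e : nat -> R, e n @[n --> \oo] --> (0 : R) &
     forall n : nat, (2 <= n)%N ->
       exists2 N : nat,
         is_bipartite_ramsey_number 4 (@cycle_graph (2 * n)%N) N &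
         N%:R = (5 + e n) * n%:R)
  /\
  (exists2 e : nat -> R, e n @[n --> \oo] --> (0 : R) &
     forall n : nat, (1 <= n)%N ->
       exists2 N : nat,
         is_bipartite_ramsey_number 4 (@path_graph (2 * n)%N) N &
         N%:R = (5 + e n) * n%:R).
Proof.
have lower n N : (0 < n)%N -> bipartite_arrows 4 (@cycle_graph (2 * n)) N -> (5 * n < N + 5)%N.
  by move=> n0 arr; apply: path_lower_bound => //; apply: path_of_cycle_arrows; rewrite // muln_gt0.
have upper r : (0 < r)%N -> exists n0, forall n, (n0 <= n)%N -> exists2 N,
    bipartite_arrows 4 (@cycle_graph (2 * n)) N & (r * N <= (5 * r + 1) * n + r)%N.
  (* Applied with r + 1 >= 2 and N = 5n + m + 1, where m is the quotient of n by r + 1: then n < (r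
     + 1)(m + 1) gives the hypothesis on N, 2m <= n keeps N below 6n, and rm <= n bounds rN. *)
  move=> r0; have [n0 hn0] := cycle_upper_bound (ltn0Sn r).
  exists (n0 + 1)%N => n nn0; pose m := (n %/ r.+1)%N.
  have h1 : (n < r.+1 * m.+1)%N by rewrite mulnC; apply: ltn_ceil.
  have h2 : (r.+1 * m <= n)%N by rewrite mulnC leq_trunc_div.
  have h3 : (2 * m <= n)%N by apply: leq_trans h2; rewrite leq_mul2r ltnS r0 orbT.
  exists (5 * n + m.+1)%N; last by move: h2; clear; nia.
  by apply: hn0; [move: nn0|move: h1|move: h3 nn0]; clear; nia.
(* Cycles and paths are treated alike: the upper bound only needs that arrowing the cycle implies
   arrowing [G]. *)
have ramsey (V : nat -> finType) (G : forall n, rel (V n)) :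
    (forall n N, (0 < n)%N -> bipartite_arrows 4 (@cycle_graph (2 * n)) N -> bipartite_arrows 4 (@G n) N) ->
    (forall n N, (0 < n)%N -> bipartite_arrows 4 (@G n) N -> (5 * n < N + 5)%N) ->
    exists2 e : nat -> R, e n @[n --> \oo] --> (0 : R) &
     forall n : nat, (1 <= n)%N ->
       exists2 N : nat, is_bipartite_ramsey_number 4 (@G n) N & N%:R = (5 + e n) * n%:R.
  move=> arrG lowG.
  have ex n : exists N, (0 < n)%N -> is_bipartite_ramsey_number 4 (@G n) N.
    case: n => [|n]; first by exists 0%N.
    have [N arr] := @cycle_arrows_exists n.+1 isT.
    have [|N' hN'] := @least_nat (bipartite_arrows 4 (@G n.+1)).
      by exists N; apply: arrG.
    by exists N'.
  have [N hN] := choice ex.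
  exists (fun n => (N n)%:R / n%:R - 5).
    apply: cvg_ratio_sub5 => r r0; have [n0 hn0] := upper r r0.
    exists n0.+1 => n nn0; have n_pos : (0 < n)%N by apply: leq_trans nn0.
    have [arr minN] := hN n n_pos; split; first exact: lowG.
    have [N' arr' le] := hn0 n (ltnW nn0); apply: leq_trans le.
    by rewrite leq_mul2l minN ?orbT //; apply: arrG.
  move=> n n0; exists (N n); first exact: hN.
  by field; rewrite pnatr_eq0 -lt0n.
split; last first.
  apply: ramsey => [n N n0|n N n0]; last exact: path_lower_bound.
  by apply: path_of_cycle_arrows; rewrite muln_gt0.
have [e cve he] := ramsey (fun n => 'I_(2 * n)) (fun n => @cycle_graph (2 * n)) (fun _ _ _ => id) lower.
by exists e => // n n2; apply: he; apply: ltnW.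
Qed.
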